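(* Let $k\geq 3$ be an odd integer. The following two assertions are equivalent. (i) For every integer $v>1$: there exists a $k$-sun system of $K_v$ if and only if $v\geq 2k$ and $v(v-1)\equiv 0 \pmod{4k}$. (ii) For every integer $v$ with $2k<v<6k$ and $v(v-1)\equiv 0\pmod{4k}$, there exists a $k$-sun system of $K_v$.
   Context: $K_v$ is the complete graph on $v$ vertices. For $k\ge 3$, the $k$-sun is the graph on $2k$ vertices obtained from a cycle $(x_1,\dots,x_k)$ of length $k$ by attaching to each $x_i$ one pendant edge $\{x_i,x_i'\}$, where $x_1',\dots,x_k'$ are $k$ distinct further vertices. A $k$-sun system of a graph $K$ is a set of subgraphs of $K$, each isomorphic to the $k$-sun, whose edge-sets partition the edge-set of $K$. *)

(* Defs.v *)
From mathcomp Require Import all_boot.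

Set Implicit Arguments.
Unset Strict Implicit.
Unset Printing Implicit Defensive.

(* A graph on vertices taken from a finite type T is a pair (vertex set, edge
   set), an edge being a set of vertices. The pair alone carries no
   constraint: it is a simple graph when it satisfies [simple_graph]. *)
Notation graph T := ({set T} * {set {set T}})%type.

Definition vertices (T : finType) (G : graph T) : {set T} := G.1.

Definition edges (T : finType) (G : graph T) : {set {set T}} := G.2.

Definition simple_graph (T : finType) (G : graph T) : bool :=
  [forall e in edges G, (e \subset vertices G) && (#|e| == 2)].

Definition subgraph (T : finType) (H G : graph T) : bool :=
  [&& simple_graph H, vertices H \subset vertices G & edges H \subset edges G].

Definition isomorphic (T U : finType) (G : graph T) (H : graph U) : Prop :=
  exists f : {x | x \in vertices G} -> {y | y \in vertices H},
    bijective f /\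
    forall x y, ([set val x; val y] \in edges G) =
                ([set val (f x); val (f y)] \in edges H).

Definition complete_graph (v : nat) : graph 'I_v :=
  ([set: 'I_v], [set e : {set 'I_v} | #|e| == 2]).

(* [inl i] is the cycle vertex x_i and [inr i] is the pendant vertex x_i';
   [ordS] is the successor modulo k. This is the k-sun for k >= 3. *)
Definition sun (k : nat) : graph ('I_k + 'I_k)%type :=
  ([set: ('I_k + 'I_k)%type],
   [set [set inl i; inl (ordS i)] | i : 'I_k]
     :|: [set [set inl i; inr i] | i : 'I_k]).

(* The injectivity clause makes the partition one by the family of edge-sets
   indexed by S: distinct members of S have disjoint edge-sets. *)
Definition sun_system (k : nat) (T : finType) (K : graph T)
    (S : {set graph T}) : Prop :=
  [/\ forall H, H \in S -> subgraph H K /\ isomorphic (sun k) H,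
      {in S &, injective (@edges T)}
    & partition [set edges H | H in S] (edges K)].

Lemma complete_graph_simple (v : nat) : simple_graph (complete_graph v).
Proof. by apply/forall_inP => e; rewrite inE subsetT. Qed.

Lemma sun_simple (k : nat) : 1 < k -> simple_graph (sun k).
Proof.
move=> k_gt1; apply/forall_inP => e; rewrite subsetT /= inE.
case/orP=> /imsetP[i _ ->]; rewrite cards2 //.
suff: i != ordS i by move=> ne; rewrite (inj_eq (@inl_inj _ _)) ne.
rewrite -val_eqE /=; have := ltn_ord i; rewrite leq_eqVlt => /orP[/eqP Ei|lt_ik].
  by rewrite Ei modnn; apply/eqP => i0; move: k_gt1; rewrite -Ei i0.
by rewrite modn_small // neq_ltn ltnSn.
Qed.

(* Main.v *)
(* A family of k-suns covering all edges of a graph, with no more suns than the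
   number of edges allows, decomposes it; so only coverings by the right number
   of suns have to be built.

   Write v = 4kq + r with 2k < r < 6k (v >= 6k). Then r is again admissible, and
   K_v is the union of a system of K_r with a decomposition of the "hole"
   K_v - K_r. For q = 1 put 4k of the vertices on two levels of Z/k, each taken
   twice. The doubles of the Hamiltonian cycles of K_k on each level are unions
   of suns, and suns rotating over Z/k absorb the edges between the levels and
   those to the r remaining vertices: with G = ceil(r/k) and d = kG - r, they use
   up d consecutive differences between the levels, and the other differences
   are attached as leaves to Hamiltonian cycles. Admissibility of r gives
   k | d(d + 1), which keeps d away from 1, 2, 3, and d = 0 is treated with one
   more unit step inside a level. A commutative quasigroup with holes on the
   levels, together with a zigzag k-cycle over each pair of levels, then
   multiplies the size of the hole by any odd number and by 4; so q = 1 and q = 2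
   suffice. The case k = 3 and two further cases with k = 5 are given by
   tables. *)
Require Import Defs.
From mathcomp Require Import all_boot.
From mathcomp Require Import all_order all_algebra zify.

Set Implicit Arguments.
Unset Strict Implicit.
Unset Printing Implicit Defensive.

Import GRing.Theory.

(** * Coverings by suns *)

Section Cover.

Variable k : nat.
Hypothesis k_gt0 : 0 < k.

(** On the doubled vertices, every difference between the two levels, every outer vertex and every
    Hamiltonian cycle of a level accounts for 4k edges, that is, for two suns. A gadget of 2k suns
    therefore absorbs differences and outer vertices that are k in number together; this is where d
    + r = kG comes from, and where a difference is absorbed does not affect the total count. Only
    the 2k vertical edges amount to a single sun and have to be mixed with others.

    A gadget needs a difference of its own or shares one with a single other gadget, so G <= 2d is
    required. As r = -d modulo k, admissibility makes d(d + 1) a multiple of k, and the bound then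
    holds for r < 10k up to a few exceptions, but not for arbitrary r. Hence large v are not reached
    by adding 4k vertices again and again, but by multiplication. A factor 2 is out of reach there,
    since the product of elements of two holes of the quasigroup has to lie in a third one; so q = 2
    is obtained by adding 4k vertices twice. *)

Definition sun_labelling (V : Type) (c l : nat -> V) : Prop :=
  [/\ {in gtn k &, injective c}, {in gtn k &, injective l}
    & forall i j, i < k -> j < k -> c i <> l j].

Definition sun_edge (V : Type) (c l : nat -> V) (x y : V) : Prop :=
  exists2 i, i < k & x = c i /\ (y = c (i.+1 %% k) \/ y = l i).

Definition sun_adj (V : Type) (c l : nat -> V) (x y : V) : Prop :=
  sun_edge c l x y \/ sun_edge c l y x.

(* The suns may overlap or leave E. *)
Definition sun_cover (V : Type) (E : V -> V -> Prop) (n : nat) : Prop :=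
  exists (T : finType) (c l : T -> nat -> V),
    [/\ #|T| = n, forall t, sun_labelling (c t) (l t)
      & forall x y, E x y -> exists t, sun_adj (c t) (l t) x y].

Lemma sun_adjC V (c l : nat -> V) x y : sun_adj c l x y -> sun_adj c l y x.
Proof. by case; [right | left]. Qed.

Lemma sun_adj_next V (c l : nat -> V) i : i.+1 < k -> sun_adj c l (c i) (c i.+1).
Proof.
by move=> lt_ik; left; exists i; [exact: ltnW | rewrite modn_small //; split; [|left]].
Qed.

Lemma sun_adj_close V (c l : nat -> V) : sun_adj c l (c k.-1) (c 0).
Proof.
by left; exists k.-1; rewrite ?prednK // modnn; split=> //; left.
Qed.

Lemma sun_adj_leaf V (c l : nat -> V) i : i < k -> sun_adj c l (c i) (l i).
Proof. by move=> lt_ik; left; exists i => //; split=> //; right. Qed.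

(** Adjacency in a sun is symmetric while the covered relations need not be: with [f := id] this
    allows each edge to be listed in one orientation only. *)
Lemma sun_cover_map (U V : Type) (f : U -> V) (E : U -> U -> Prop)
    (E' : V -> V -> Prop) n :
  injective f -> sun_cover E n ->
  (forall x y, E' x y ->
     exists x' y', [/\ x = f x', y = f y' & E x' y' \/ E y' x']) ->
  sun_cover E' n.
Proof.
move=> f_inj [T [c [l [cardT lab cov]]]] EE'.
exists T, (fun t i => f (c t i)), (fun t i => f (l t i)); split=> //.
  move=> t; have [c_inj l_inj cl] := lab t; split.
  - by move=> i j lti ltj /f_inj; apply: c_inj.
  - by move=> i j lti ltj /f_inj; apply: l_inj.
  - by move=> i j lti ltj /f_inj; apply: cl.
have adj_f t x y : sun_adj (c t) (l t) x y ->
    sun_adj (fun i => f (c t i)) (fun i => f (l t i)) (f x) (f y).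
  by case=> [] [i lti [-> [] ->]]; [left|left|right|right]; exists i => //;
     split=> //; [left|right|left|right].
move=> _ _ /EE'[x [y [-> -> Exy]]].
case: Exy => /cov[t /adj_f adj_t]; exists t => //; exact: sun_adjC.
Qed.

Lemma sun_coverS (V : Type) (E E' : V -> V -> Prop) n :
  (forall x y, E' x y -> E x y) -> sun_cover E n -> sun_cover E' n.
Proof.
move=> EE' cov; apply: (@sun_cover_map V V id E E' n) => // x y /EE' Exy.
by exists x, y; split=> //; left.
Qed.

Lemma sun_coverU (V : Type) (E1 E2 : V -> V -> Prop) n1 n2 :
  sun_cover E1 n1 -> sun_cover E2 n2 ->
  sun_cover (fun x y => E1 x y \/ E2 x y) (n1 + n2).
Proof.
move=> [T1 [c1 [l1 [card1 lab1 cov1]]]] [T2 [c2 [l2 [card2 lab2 cov2]]]].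
exists (T1 + T2)%type.
exists (fun t => match t with inl t => c1 t | inr t => c2 t end).
exists (fun t => match t with inl t => l1 t | inr t => l2 t end).
split; first by rewrite card_sum card1 card2.
  by case.
by move=> x y [/cov1[t adj_t]|/cov2[t adj_t]]; [exists (inl t)|exists (inr t)].
Qed.

Lemma sun_cover_big (V : Type) (I : finType) (E : I -> V -> V -> Prop) (n : I -> nat) :
  (forall i, sun_cover (E i) (n i)) ->
  sun_cover (fun x y => exists i, E i x y) (\sum_i n i).
Proof.
move=> cov.
suff H (s : seq I) : sun_cover (fun x y => exists2 i, i \in s & E i x y) (\sum_(i <- s) n i).
  rewrite -big_enum; apply: sun_coverS (H _) => x y [i Exy].
  by exists i => //; rewrite mem_enum.
elim: s => [|i s IHs].
  rewrite big_nil; exists void, (@of_void _), (@of_void _).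
  by split=> [|[]|x y []//]; rewrite card_void.
rewrite big_cons; apply: sun_coverS (sun_coverU (cov i) IHs) => x y [j].
by rewrite inE => /predU1P[->|js] Exy; [left|right; exists j].
Qed.

End Cover.

(** * Sun systems of complete graphs as coverings *)

Section Copies.

Variables (T U : finType) (g : T -> U).
Hypothesis g_inj : injective g.

Definition copy (G : graph T) : graph U :=
  (g @: vertices G, [set g @: (e : {set T}) | e in edges G]).

Lemma imset_pair x y : g @: [set x; y] = [set g x; g y].
Proof. by rewrite imsetU1 imset_set1. Qed.

Lemma isomorphic_copy (G : graph T) : isomorphic G (copy G).
Proof.
have gP (x : {x | x \in vertices G}) : g (val x) \in vertices (copy G).
  by apply: imset_f; exact: valP.
pose f (x : {x | x \in vertices G}) : {y | y \in vertices (copy G)} :=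
  exist _ (g (val x)) (gP x).
have f_inj : injective f by move=> x y [] /g_inj /val_inj.
exists f; split.
  by apply: inj_card_bij => //; rewrite !card_sig card_imset.
move=> x y; rewrite /= -imset_pair.
by rewrite (mem_imset _ _ (imset_inj g_inj)).
Qed.

End Copies.

(** [isomorphic] compares only sets of the form {x, y}, so the edges on both sides must be known to
    have this form before the edge sets can be identified. *)
Lemma isomorphic_setT (T U : finType) (E : {set {set T}}) (H : graph U) :
  simple_graph H -> isomorphic ([set: T], E) H -> (forall e, e \in E -> #|e| = 2) ->
  exists2 g : T -> U, injective g & H = copy g ([set: T], E).
Proof.
move=> /forall_inP simpH [f [f_bij fE]] simpE.
pose g x := val (f (exist _ x (in_setT x))).
have g_inj : injective g.
  by move=> x y /val_inj /(bij_inj f_bij) [].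
have [f' ff' f'f] := f_bij.
have gf' (y : {y | y \in vertices H}) : g (val (f' y)) = val y.
  by rewrite -{2}(f'f y) /g; congr (val (f _)); apply: val_inj.
have gE x y : ([set x; y] \in E) = ([set g x; g y] \in edges H).
  exact: (fE (exist _ x (in_setT x)) (exist _ y (in_setT y))).
exists g => //; rewrite (surjective_pairing H); congr (_, _).
  apply/setP=> y; apply/idP/imsetP => [yH | [x _ ->]]; last exact: valP.
  by exists (val (f' (exist _ y yH))); rewrite ?in_setT // gf'.
apply/setP=> e; apply/idP/imsetP => [eH | [e' e'E ->]].
  have /andP[/subsetP eV /cards2P[a [b [_ Ee]]]] := simpH e eH.
  have aV : a \in vertices H by apply: eV; rewrite Ee !inE eqxx.
  have bV : b \in vertices H by apply: eV; rewrite Ee !inE eqxx orbT.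
  exists [set val (f' (exist _ a aV)); val (f' (exist _ b bV))].
    by rewrite gE !gf' /= -Ee.
  by rewrite imset_pair !gf'.
have /eqP/cards2P[a [b [_ Ee']]] := simpE _ e'E.
by move: e'E; rewrite Ee' gE imset_pair.
Qed.

Lemma card_sun_edges k : 2 < k -> #|edges (sun k)| = 2 * k.
Proof.
move=> k_gt2; rewrite cardsU !card_imset ?card_ord.
- rewrite [X in _ - X](_ : _ = 0) ?subn0 ?mul2n ?addnn //.
  apply/eqP; rewrite cards_eq0; apply/set0Pn => -[e /setIP[]].
  case/imsetP=> i _ -> /imsetP[j _ /setP/(_ (inr j))].
  by rewrite !inE eqxx orbT.
- move=> i j /setP Eij; move: (Eij (inr i)); rewrite !inE eqxx orbT /=.
  by move/esym/eqP=> [].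
move=> i j /setP Eij; move: (Eij (inl i)) (Eij (inl (ordS i))).
have inlE (x y : 'I_k) : (inl x == inl y :> 'I_k + 'I_k) = (x == y) by [].
rewrite !inE !inlE !eqxx orbT /= => /esym/orP[/eqP //|/eqP Ei].
case/esym/orP=> /eqP; last exact: ordS_inj.
(* A repeated cycle edge with i different from j forces i = j + 1 and j = i + 1, hence i + 2 = i
   modulo k, which k > 2 excludes. *)
move=> Ej; have := congr1 val Ei; rewrite /= -Ej /= => Ek; have := ltn_ord i.
case: (ltnP i.+1 k) => [lt1|ge1 lti].
  rewrite (modn_small lt1) in Ek; case: (ltnP i.+2 k) => lt2.
    by rewrite modn_small // in Ek; lia.
  have E2 : i.+2 = k by lia.
  by rewrite E2 modnn in Ek; lia.
have E1 : i.+1 = k by lia.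
by rewrite E1 modnn modn_small in Ek; lia.
Qed.

Lemma card_complete_edges v : #|edges (complete_graph v)| * 2 = v * (v - 1).
Proof.
rewrite /edges /= card_draws card_ord bin2 muln2 subn1.
case: v => [|v] //=; rewrite -[RHS]odd_double_half oddM /= andNb add0n //.
Qed.

Section Systems.

Variables k v : nat.
Hypothesis k_gt2 : 2 < k.

Definition sun_vertex (V : Type) (c l : nat -> V) (x : 'I_k + 'I_k) : V :=
  match x with inl i => c i | inr i => l i end.

Lemma sun_vertex_inj (V : Type) (c l : nat -> V) :
  sun_labelling k c l -> injective (sun_vertex c l).
Proof.
case=> c_inj l_inj cl [i|i] [j|j] /=.
- by move/(c_inj _ _ (ltn_ord i) (ltn_ord j))/val_inj ->.
- by move/(cl _ _ (ltn_ord i) (ltn_ord j)).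
- by move/esym/(cl _ _ (ltn_ord j) (ltn_ord i)).
- by move/(l_inj _ _ (ltn_ord i) (ltn_ord j))/val_inj ->.
Qed.

(** With E the edge set of the complete graph, the chain |E| <= |cover P| <= |P| 2k <= |S| 2k <= n
    2k = |E| consists of equalities: the second one makes the edge sets disjoint, the third one
    makes [edges] injective on [S]. *)
Lemma sun_system_of_cover n :
  sun_cover k (fun x y : 'I_v => x <> y) n -> n * (4 * k) = v * (v - 1) ->
  exists S, sun_system k (complete_graph v) S.
Proof.
move=> [T [c [l [cardT lab cov]]]] Dn.
pose H t := copy (sun_vertex (c t) (l t)) (sun k).
have vert_inj t := sun_vertex_inj (lab t).
have edge_H t e : e \in edges (H t) -> #|e| = 2.
  case/imsetP=> e' e'k ->; rewrite card_imset //.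
  have /forall_inP/(_ _ e'k)/andP[_ /eqP//] := sun_simple (ltnW k_gt2).
pose S := [set H t | t : T]; pose P := [set edges G | G in S].
have sub_cov : edges (complete_graph v) \subset cover P.
  apply/subsetP=> e; rewrite inE => /cards2P[x [y [/eqP ne_xy ->]]].
  have [t adj_t] := cov _ _ ne_xy.
  apply/bigcupP; exists (edges (H t)).
    by apply: imset_f; apply: imset_f.
  have edge_t a b : sun_edge k (c t) (l t) a b -> [set a; b] \in edges (H t).
    case=> i lt_ik [-> [] ->]; apply/imsetP.
      exists [set inl (Ordinal lt_ik); inl (ordS (Ordinal lt_ik))].
        by apply/setUP; left; apply: imset_f.
      by rewrite imset_pair.
    exists [set inl (Ordinal lt_ik); inr (Ordinal lt_ik)].
      by apply/setUP; right; apply: imset_f.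
    by rewrite imset_pair.
  by case: adj_t => /edge_t //; rewrite setUC.
have card_P : \sum_(A in P) #|A| = #|P| * (2 * k).
  rewrite -sum_nat_const; apply: eq_bigr => A /imsetP[G /imsetP[t _ ->] ->].
  by rewrite card_imset ?card_sun_edges //; apply: imset_inj.
have leP := leq_card_cover P; have leS : #|P| <= #|S| := leq_imset_card _ _.
have leT : #|S| <= n by rewrite -cardT; apply: leq_imset_card.
have cardE : #|edges (complete_graph v)| = n * (2 * k).
  by have := card_complete_edges v; lia.
have le_cov := subset_leq_card sub_cov.
have k2 : 0 < 2 * k by lia.
have le_n : n <= #|P|.
  rewrite -(leq_pmul2r k2) -cardE -card_P (leq_trans le_cov) //.
  exact: leP.
have P_eq : #|P| = n by lia.
exists S; split.
- move=> G /imsetP[t _ ->]; split; last exact: isomorphic_copy.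
  apply/and3P; split.
  + apply/forall_inP => e eH; rewrite (edge_H _ _ eH) eqxx andbT.
    case/imsetP: eH => e' e'k ->; apply: imsetS.
    by have /forall_inP/(_ _ e'k)/andP[] := sun_simple (ltnW k_gt2).
  + by rewrite subsetT.
  + by apply/subsetP=> e eH; rewrite inE (edge_H _ _ eH).
- by apply/imset_injP; rewrite eqn_leq leS P_eq.
have trivP : trivIset P.
  apply/eqnP; rewrite card_P P_eq -cardE; congr #|pred_of_set _|.
  apply/eqP; rewrite eqEsubset sub_cov; apply/bigcupsP=> A /imsetP[G /imsetP[t _ ->] ->].
  by apply/subsetP=> e eH; rewrite inE (edge_H _ _ eH).
apply/and3P; split=> //.
  rewrite eqEsubset sub_cov andbT; apply/bigcupsP=> A /imsetP[G /imsetP[t _ ->] ->].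
  by apply/subsetP=> e eH; rewrite inE (edge_H _ _ eH).
apply/imsetP=> -[G /imsetP[t _ ->]] /setP E0.
have lt0k : 0 < k by lia.
have := E0 (sun_vertex (c t) (l t) @: [set inl (Ordinal lt0k); inr (Ordinal lt0k)]).
rewrite in_set0 => /esym/negP; apply; apply: imset_f.
by apply/setUP; right; apply: imset_f.
Qed.

Lemma cover_of_sun_system S : 1 < v -> sun_system k (complete_graph v) S ->
  [/\ 2 * k <= v, #|S| * (4 * k) = v * (v - 1)
    & sun_cover k (fun x y : 'I_v => x <> y) #|S|].
Proof.
move=> v_gt1 [subS injS partS].
have edge2 e : e \in edges (sun k) -> #|e| = 2.
  by move=> ek; have /forall_inP/(_ _ ek)/andP[_ /eqP//] := sun_simple (ltnW k_gt2).
have copyS G : G \in S -> exists2 g : 'I_k + 'I_k -> 'I_v, injective g & G = copy g (sun k).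
  by move=> /subS[/and3P[simpG _ _] isoG]; apply: isomorphic_setT.
have [covS trivS _] := and3P partS.
have card_S : #|S| * (2 * k) = #|edges (complete_graph v)|.
  rewrite -(eqP covS) -(eqnP trivS) -(card_in_imset injS) -sum_nat_const.
  apply: eq_bigr => A /imsetP[G /copyS[g g_inj ->] ->].
  by rewrite card_imset ?card_sun_edges //; apply: imset_inj.
have Dv := card_complete_edges v.
have S_gt0 : 0 < #|S| by lia.
split; [|lia|].
  have [G GS] := card_gt0P S_gt0.
  have [g g_inj _] := copyS _ GS; have := leq_card g g_inj.
  by rewrite card_sum !card_ord; lia.
have lt0k : 0 < k by lia.
(* Default value of the labellings at indices from [k] on, which are never read. *)
have i0 : 'I_k := Ordinal lt0k.
have : forall t : {G | G \in S}, exists g : 'I_k + 'I_k -> 'I_v,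
    injective g /\ val t = copy g (sun k).
  by move=> [G GS] /=; have [g] := copyS _ GS; exists g.
case/fin_all_exists=> g gP.
exists {G | G \in S}.
exists (fun t i => g t (inl (insubd i0 i))), (fun t i => g t (inr (insubd i0 i))).
have val_insubd i : i < k -> val (insubd i0 i) = i by move=> ?; rewrite insubdK.
split; first by rewrite card_sig; apply: eq_card.
  move=> t; have [g_inj _] := gP t; split.
  - move=> i j lt_i lt_j /g_inj[] /(congr1 val); rewrite /= !val_insubd //.
  - move=> i j lt_i lt_j /g_inj[] /(congr1 val); rewrite /= !val_insubd //.
  - by move=> i j _ _ /g_inj.
move=> x y ne_xy.
have: [set x; y] \in cover [set edges H | H in S].
  by rewrite (eqP covS) inE cards2; move/eqP: ne_xy => ->.
case/bigcupP=> _ /imsetP[G GS ->] /=.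
pose t : {G | G \in S} := exist _ G GS.
have [g_inj EG] := gP t; rewrite -[G]/(val t) EG => /imsetP[e eE Exy].
exists t.
have adj_e (a b : 'I_k + 'I_k) : [set x; y] = [set g t a; g t b] ->
    (x = g t a /\ y = g t b) \/ (x = g t b /\ y = g t a).
  move=> /setP E; move: (E x) (E y) (E (g t a)) (E (g t b)).
  rewrite !inE !eqxx !orbT /= => /esym/orP[]/eqP-> /esym/orP[]/eqP->.
  - by move=> _ /orP[]/eqP ->; left.
  - by left.
  - by right.
  - by move=> /orP[]/eqP -> _; left.
move: eE Exy; rewrite inE => /orP[]/imsetP[i _ ->]; rewrite imset_pair.
  move/adj_e=> [[-> ->]|[-> ->]]; [left|right]; exists i => //;
    (split; [congr (g t (inl _)); apply: val_inj; rewrite /= val_insubd //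
            |left; congr (g t (inl _)); apply: val_inj; rewrite /= val_insubd //; exact: ltn_pmod]).
move/adj_e=> [[-> ->]|[-> ->]]; [left|right]; exists i => //;
    (split; [congr (g t (inl _)); apply: val_inj; rewrite /= val_insubd //
            |right; congr (g t (inr _)); apply: val_inj; rewrite /= val_insubd //]).
Qed.

End Systems.

(** * Doubled cycles and doubled suns *)

Section Doubling.

Variable k : nat.
Hypothesis k_gt2 : 2 < k.

Let k_gt0 : 0 < k. Proof. lia. Qed.

Definition cycle_edge (B : Type) (c : nat -> B) (x y : B) : Prop :=
  exists2 i, i < k & x = c i /\ y = c (i.+1 %% k).

Lemma succ_modE i : i < k -> i.+1 %% k = if i.+1 < k then i.+1 else 0.
Proof.
move=> lt_ik; case: ltnP => [lt1|ge1]; first exact: modn_small.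
have -> : i.+1 = k by lia.
exact: modnn.
Qed.

Lemma succ_mod_lt i : i.+1 %% k < k.
Proof. exact: ltn_pmod. Qed.

Lemma succ_mod_inj i j : i < k -> j < k -> i.+1 %% k = j.+1 %% k -> i = j.
Proof. by move=> lt_i lt_j; rewrite !succ_modE //; case: ltnP => ?; case: ltnP => ?; lia. Qed.

(** One sun for each copy: the edges inside the copy form its cycle, and the edges that change the
    copy are pendant. *)
Lemma cover_double_cycle (B : Type) (c : nat -> B) :
  {in gtn k &, injective c} ->
  sun_cover k (fun x y : B * bool => cycle_edge c x.1 y.1) 2.
Proof.
move=> c_inj.
exists bool, (fun e i => (c i, e)), (fun e i => (c (i.+1 %% k), ~~ e)).
split; first by rewrite card_bool.
  move=> e; split.
  - by move=> i j lt_i lt_j [] /c_inj; apply.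
  - move=> i j lt_i lt_j [] /(c_inj _ _ (succ_mod_lt i) (succ_mod_lt j)).
    exact: succ_mod_inj.
  - by move=> i j _ _ []; case: e.
move=> [x e] [y e'] [i lt_ik /= [-> ->]]; exists e; left; exists i => //.
by split=> //; case: (e) (e') => [] []; [left|right|right|left].
Qed.

Hypothesis k_odd : odd k.

(* A proper 3-colouring of the odd cycle; together with the constant section it
   splits the double of a k-cycle into four sections, each a k-cycle. *)
Definition colour i := if i == k.-1 then 3 else if odd i then 2 else 1.

Lemma colour_bound i : 1 <= colour i <= 3.
Proof. by rewrite /colour; case: ifP => // _; case: odd. Qed.

Lemma colour_next i : i < k -> colour i != colour (i.+1 %% k).
Proof. by move=> lt_ik; rewrite succ_modE // /colour; case: ltnP => ?; do !case: ifP => ?; lia. Qed.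

Definition section_bit (a i : nat) := (a != 0) && (a != colour i).

(** The remaining element of {1, 2, 3}, whose sum is 6. *)
Definition third a b := 6 - a - b.

(* Of the two non-constant sections through [(c i, true)], the one whose leaf
   is in the upper copy. *)
Definition upper_leaf i := if colour i == 3 then 2 else 3.

(** The four sections are the cycles. At each position two of them pass through either copy of
    [c i], and the leaf bits send these two to different copies of [u i]. *)
Lemma cover_double_sun (B : Type) (c u : nat -> B) :
  sun_labelling k c u ->
  sun_cover k (fun x y : B * bool => sun_edge k c u x.1 y.1) 4.
Proof.
move=> [c_inj u_inj cu].
pose leaf_bit (a i : nat) := (a != 0) && ((a == colour i) || (a == upper_leaf i)).
exists 'I_4, (fun (a : 'I_4) i => (c i, section_bit a i)),
  (fun (a : 'I_4) i => (u i, leaf_bit a i)).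
split; first by rewrite card_ord.
  move=> a; split.
  - by move=> i j lt_i lt_j [/c_inj ij _]; apply: ij.
  - by move=> i j lt_i lt_j [/u_inj ij _]; apply: ij.
  - by move=> i j lt_i lt_j [] /(cu _ _ lt_i lt_j).
move=> [x e] [y e'] [i lt_ik /= [-> ye]].
have zi := colour_bound i; have zi' := colour_bound (i.+1 %% k).
have zz := colour_next lt_ik.
suff [a lt_a [sa ya]] : exists2 a, a < 4 & section_bit a i = e /\
    (y = c (i.+1 %% k) /\ section_bit a (i.+1 %% k) = e' \/ y = u i /\ leaf_bit a i = e').
  exists (Ordinal lt_a); left; exists i => //=; rewrite sa; split=> //.
  by case: ya => -[-> ->]; [left|right].
case: ye => ->.
  case: e e' => [] [].
  - exists (third (colour i) (colour (i.+1 %% k))); rewrite /third; first lia.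
    by rewrite /section_bit; split; [|left; split=> //]; lia.
  - exists (colour (i.+1 %% k)); first lia.
    by rewrite /section_bit; split; [|left; split=> //]; lia.
  - exists (colour i); first lia.
    by rewrite /section_bit; split; [|left; split=> //]; lia.
  - by exists 0 => //; split=> //; left.
have: colour i != upper_leaf i /\ 1 <= upper_leaf i <= 3.
  by rewrite /upper_leaf; case: (colour i =P 3) => ?; lia.
case=> zu ub; case: e e' => [] [].
- exists (upper_leaf i); first lia.
  by rewrite /section_bit /leaf_bit; split; [|right; split=> //]; lia.
- exists (third (colour i) (upper_leaf i)); rewrite /third; first lia.
  by rewrite /section_bit /leaf_bit; split; [|right; split=> //]; lia.
- exists (colour i); first lia.
  by rewrite /section_bit /leaf_bit; split; [|right; split=> //]; lia.
- by exists 0 => //; split=> //; right.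
Qed.

Definition pred_mod i := if i == 0 then k.-1 else i.-1.

Lemma pred_mod_lt i : i < k -> pred_mod i < k.
Proof. by rewrite /pred_mod; case: eqP; lia. Qed.

Lemma pred_modK i : i < k -> (pred_mod i).+1 %% k = i.
Proof.
move=> lt_i; rewrite succ_modE ?pred_mod_lt //.
by rewrite /pred_mod; case: eqP; case: ltnP; lia.
Qed.

Lemma succ_modK i : i < k -> pred_mod (i.+1 %% k) = i.
Proof.
move=> lt_i; apply: succ_mod_inj => //; first by rewrite pred_mod_lt ?succ_mod_lt.
by rewrite pred_modK ?succ_mod_lt.
Qed.

(* Three of the four sections over [c] are cycles of suns, the constant one
   being used up as leaf edges; with all four sections over [d] this makes
   seven suns, an odd number, which is what absorbs the 2k vertical edges. *)
Lemma cover_linked_cycles (B : Type) (c d u w : nat -> B) :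
    sun_labelling k c u -> sun_labelling k d w ->
    (forall i, i < k -> exists2 j, j < k & u i = d j /\ w j = c i) ->
  sun_cover k (fun x y : B * bool =>
      (exists2 i, i < k & x.1 = c i /\ (y.1 = c (i.+1 %% k) \/ y.1 = u i)) \/
      cycle_edge d x.1 y.1 \/
      (x.1 = y.1 /\ x.2 <> y.2 /\ exists2 i, i < k & x.1 = c i \/ x.1 = d i)) 7.
Proof.
move=> [c_inj u_inj cu] [d_inj w_inj dw] uw.
(* At position i, the section of colour i supplies the edge of the dropped constant section, the
   section of the colour before i takes the edge from [(c i, true)] to [(u i, false)], and the third
   one the vertical edge. Leaves stay distinct because the section whose leaf at i - 1 is
   [(c i, false)] uses [u i] at i. *)
pose c_leaf (a i : nat) := if a == colour i then (c (i.+1 %% k), false) else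
  if a == colour (pred_mod i) then (u i, false) else (c i, false).
(* The edge from [(d j, false)] to [(w j, true)] is already covered from the side of [c]; its place
   goes to the vertical edge at [d j]. *)
pose d_leaf (a j : nat) := if a == 0 then (w j, false) else
  if a == colour j then (d j, true) else (w j, a == upper_leaf j).
have sec1 a i : section_bit a.+1 i = (a.+1 != colour i) by [].
have cover_c : sun_cover k (fun x y : B * bool =>
    [\/ exists2 i, i < k & x.1 = c i /\ y.1 = c (i.+1 %% k),
        exists2 i, i < k & x = (c i, true) /\ y = (u i, false)
      | exists2 i, i < k & x = (c i, true) /\ y = (c i, false)]) 3.
  exists 'I_3, (fun (a : 'I_3) i => (c i, section_bit a.+1 i)), (fun a : 'I_3 => c_leaf a.+1).
  split; first by rewrite card_ord.
    move=> a; split.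
    - by move=> i j lt_i lt_j [/c_inj ij _]; apply: ij.
    - move=> i j lt_i lt_j; rewrite /c_leaf.
      case: (a.+1 =P colour i) => [ai|/eqP ai];
        case: (a.+1 =P colour j) => [aj|/eqP aj].
      + by case=> /(c_inj _ _ (succ_mod_lt i) (succ_mod_lt j)); apply: succ_mod_inj.
      + case: ifP => [_|/negbT aj'] [E]; first by case: (cu _ _ (succ_mod_lt i) lt_j).
        have ij := c_inj _ _ (succ_mod_lt i) lt_j E.
        by move: aj'; rewrite -ij succ_modK // ai eqxx.
      + case: ifP => [_|/negbT ai'] [E]; first by case: (cu _ _ (succ_mod_lt j) lt_i).
        have ij := c_inj _ _ (succ_mod_lt j) lt_i (esym E).
        by move: ai'; rewrite -ij succ_modK // aj eqxx.
      + case: ifP => _; case: ifP => _ [E]; last exact: c_inj.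
        * exact: u_inj.
        * by case: (cu _ _ lt_j lt_i).
        * by case: (cu _ _ lt_i lt_j).
    - move=> i j lt_i lt_j; rewrite sec1 /c_leaf; case: (a.+1 =P colour j) => [aj|/eqP aj].
        case=> /(c_inj _ _ lt_i (succ_mod_lt j)) ij; rewrite ij aj.
        by rewrite colour_next.
      case: ifP => _ []; first by move/(cu _ _ lt_i lt_j).
      by move/(c_inj _ _ lt_i lt_j)=> ij; rewrite ij aj.
  move=> [x e] [y e'] /= [] [i lt_i].
  - case=> -> ->; have zi := colour_bound i; have zz := colour_next lt_i.
    have zi' := colour_bound (i.+1 %% k).
    suff [a lt_a [sa ya]] : exists2 a, a < 3 & section_bit a.+1 i = e /\
        (section_bit a.+1 (i.+1 %% k) = e' \/ c_leaf a.+1 i = (c (i.+1 %% k), e')).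
      exists (Ordinal lt_a); left; exists i => //=; rewrite sa; split=> //.
      by case: ya => ->; [left|right].
    case: e e' => [] [].
    + exists (third (colour i) (colour (i.+1 %% k))).-1; rewrite /third; first lia.
      by rewrite /section_bit; split; [|left]; lia.
    + exists (colour (i.+1 %% k)).-1; first lia.
      by rewrite /section_bit; split; [|left]; lia.
    + exists (colour i).-1; first lia.
      by rewrite /section_bit; split; [|left]; lia.
    + exists (colour i).-1; first lia.
      rewrite /section_bit /c_leaf; split; [lia|right].
      by rewrite prednK ?eqxx //; lia.
  - case=> [[-> ->] [-> ->]].
    have zi := colour_bound i; have zi' := colour_bound (pred_mod i).
    have := colour_next (pred_mod_lt lt_i); rewrite pred_modK // => zz.
    have lt_a : (colour (pred_mod i)).-1 < 3 by lia.
    exists (Ordinal lt_a); left; exists i => //=; rewrite sec1 prednK; last lia.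
    by rewrite zz; split=> //; right; rewrite /c_leaf (negPf zz) eqxx.
  - case=> [[-> ->] [-> ->]].
    have zi := colour_bound i; have zi' := colour_bound (pred_mod i).
    have := colour_next (pred_mod_lt lt_i); rewrite pred_modK // => zz.
    have lt_a : (third (colour i) (colour (pred_mod i))).-1 < 3 by rewrite /third; lia.
    exists (Ordinal lt_a); left; exists i => //=.
    rewrite sec1 prednK; last by rewrite /third; lia.
    split; first by congr (_, _); rewrite /third; lia.
    by right; rewrite /c_leaf !ifN //; rewrite /third; lia.
have cover_d : sun_cover k (fun x y : B * bool =>
    [\/ exists2 j, j < k & x.1 = d j /\ y.1 = d (j.+1 %% k),
        exists2 j, j < k & x.1 = d j /\ y.1 = w j /\ x.2 || ~~ y.2
      | exists2 j, j < k & x = (d j, false) /\ y = (d j, true)]) 4.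
  exists 'I_4, (fun (a : 'I_4) i => (d i, section_bit a i)), (fun a : 'I_4 => d_leaf a).
  split; first by rewrite card_ord.
    move=> a; split.
    - by move=> i j lt_i lt_j [/d_inj ij _]; apply: ij.
    - move=> i j lt_i lt_j; rewrite /d_leaf; case: ifP => _ => [[E]|].
        exact: w_inj.
      case: ifP => _; case: ifP => _ [E].
      + exact: d_inj.
      + by case: (dw _ _ lt_i lt_j).
      + by case: (dw _ _ lt_j lt_i).
      + by case: E => E _; exact: w_inj.
    - move=> i j lt_i lt_j; rewrite /section_bit /d_leaf; case: ifP => _ /=.
        by case=> /(dw _ _ lt_i lt_j).
      case: (val a =P colour j) => [aj|_] []; last by move/(dw _ _ lt_i lt_j).
      by move/(d_inj _ _ lt_i lt_j)=> ij; rewrite ij aj eqxx.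
  move=> [x e] [y e'] /= [] [i lt_i].
  - case=> -> ->; have zi := colour_bound i; have zz := colour_next lt_i.
    have zi' := colour_bound (i.+1 %% k).
    suff [a lt_a [sa sa']] : exists2 a, a < 4 & section_bit a i = e /\
        section_bit a (i.+1 %% k) = e'.
      by exists (Ordinal lt_a); left; exists i => //=; rewrite sa sa'; split=> //; left.
    case: e e' => [] [].
    + exists (third (colour i) (colour (i.+1 %% k))); rewrite /third; first lia.
      by rewrite /section_bit; lia.
    + by exists (colour (i.+1 %% k)); [lia|rewrite /section_bit; lia].
    + by exists (colour i); [lia|rewrite /section_bit; lia].
    + by exists 0.
  - case=> -> [-> ee]; have zi := colour_bound i.
    have: colour i != upper_leaf i /\ 1 <= upper_leaf i <= 3.
      by rewrite /upper_leaf; case: (colour i =P 3) => ?; lia.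
    case=> zu ub.
    suff [a lt_a [sa sa']] : exists2 a, a < 4 & section_bit a i = e /\
        d_leaf a i = (w i, e').
      by exists (Ordinal lt_a); left; exists i => //=; rewrite sa sa'; split=> //; right.
    case: e e' ee => [] [] // _.
    + exists (upper_leaf i); first lia.
      rewrite /section_bit /d_leaf; split; first lia.
      by rewrite !ifN ?eqxx //; lia.
    + exists (third (colour i) (upper_leaf i)); rewrite /third; first lia.
      rewrite /section_bit /d_leaf; split; first lia.
      by rewrite !ifN; [congr (_, _)| |]; lia.
    + by exists 0.
  - case=> [[-> ->] [-> ->]]; have zi := colour_bound i.
    have lt_a : colour i < 4 by lia.
    exists (Ordinal lt_a); left; exists i => //=; rewrite /section_bit eqxx andbF.
    by split=> //; right; rewrite /d_leaf eqxx ifN //; lia.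
apply: (@sun_cover_map k _ _ id _ _ _ _ (sun_coverU cover_c cover_d)) => //.
move=> [x e] [y e']; case=> [[i lt_i /= [-> [->|->]]]|[[i lt_i /= [-> ->]]|/= [<-]]].
- by exists (c i, e), (c (i.+1 %% k), e'); split=> //; left; left; constructor 1; exists i.
- have [j lt_j [uj wj]] := uw i lt_i.
  exists (c i, e), (u i, e'); split=> //.
  case: (boolP (e && ~~ e')) => [/andP[-> /negPf->]|ee].
    by left; left; constructor 2; exists i.
  right; right; constructor 2; exists j => //=; rewrite uj wj.
  by split=> //; split=> //; move: ee; rewrite negb_and negbK orbC.
- by exists (d i, e), (d (i.+1 %% k), e'); split=> //; left; right; constructor 1; exists i.
case=> ne_e [i lt_i [->|->]].
  exists (c i, e), (c i, e'); split=> //.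
  by case: e e' ne_e => [] [] // _; [left|right]; left; constructor 3; exists i.
exists (d i, e), (d i, e'); split=> //.
by case: e e' ne_e => [] [] // _; [right|left]; right; constructor 3; exists i.
Qed.

End Doubling.

(** * Residues modulo n *)

Section IntegersModulo.

Variable n : nat.
Hypothesis n_gt1 : 1 < n.

Local Open Scope ring_scope.

Lemma Zmod_lt (x : 'Z_n) : (x < n)%N.
Proof. by have := ltn_ord x; rewrite [X in (_ < X)%N -> _]Zp_cast. Qed.

Lemma Zmod_nat (x : 'Z_n) : x = (x : nat)%:R.
Proof. by rewrite natr_Zp. Qed.

Lemma Zmod_nat_inj (a b : nat) : (a < n)%N -> (b < n)%N ->
  a%:R = b%:R :> 'Z_n -> a = b.
Proof.
by move=> lt_a lt_b /(congr1 val); rewrite /= !val_Zp_nat // !modn_small.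
Qed.

Lemma Zmod_period : n%:R = 0 :> 'Z_n.
Proof. by apply: val_inj; rewrite /= val_Zp_nat // modnn. Qed.

Lemma card_Zmod : #|'Z_n| = n.
Proof. by rewrite card_ord Zp_cast. Qed.

End IntegersModulo.

(** * Walecki's Hamiltonian decomposition *)

Section Walecki.

Variable m : nat.
Hypothesis m_gt0 : 0 < m.

Local Notation n := m.*2.
Local Notation k := m.*2.+1.

Let n_gt1 : 1 < n. Proof. lia. Qed.
Let k_gt1 : 1 < k. Proof. lia. Qed.

Local Open Scope ring_scope.

(* The zigzag 0, 1, -1, 2, -2, ..., whose translates, closed up through one
   further vertex, are Walecki's Hamiltonian cycles. *)
Definition zigzag (t : nat) : 'Z_n :=
  if odd t then ((t.+1)./2)%:R else - (t./2)%:R.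

Lemma zigzag_inj (s t : nat) : (s < n)%N -> (t < n)%N ->
  zigzag s = zigzag t -> s = t.
Proof.
pose code t := if odd t then (t.+1)./2 else if t == 0%N then 0%N else (n - t./2)%N.
have zE u : (u < n)%N -> zigzag u = (code u)%:R /\ (code u < n)%N.
  move=> lt_u; rewrite /zigzag /code; case: ifP => Ou; first by split=> //; lia.
  case: eqP => [->|/eqP u0]; first by rewrite oppr0; split=> //; lia.
  by rewrite natrB; [rewrite Zmod_period // add0r; split=> //; lia|lia].
move=> lt_s lt_t; have [-> cs] := zE s lt_s; have [-> ct] := zE t lt_t.
move/(Zmod_nat_inj n_gt1 cs ct); rewrite /code.
by case: ifP => ?; case: ifP => ?; do ?case: ifP => ?; lia.
Qed.

Definition walecki (i t : nat) : option 'Z_n :=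
  if t is t'.+1 then Some (i%:R + zigzag t') else None.

Lemma walecki_inj i : {in gtn k &, injective (walecki i)}.
Proof.
move=> [|s] [|t] //; rewrite !inE !ltnS => lt_s lt_t /Some_inj /addrI.
by move/zigzag_inj=> ->.
Qed.

(** Neighbouring entries of the zigzag sum alternately to 1 and to 0, so that every pair of distinct
    residues with one of these sums is a step. For the sum 0 the residues 0 and m, their own
    negatives, are excluded. *)
Lemma zigzagE (P : 'Z_n) : P != 0 -> P != m%:R ->
  exists2 j, (j < n.-1)%N &
    (zigzag j = P /\ zigzag j.+1 = - P) \/ (zigzag j = - P /\ zigzag j.+1 = P).
Proof.
move=> P0 Pm; have P0' : (P : nat) != 0%N by [].
have Pm' : (P : nat) != m.
  by apply: contraNneq Pm => E; rewrite {1}[P]Zmod_nat E.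
have lt_P := Zmod_lt n_gt1 P; set v := (P : nat) in P0' Pm' lt_P.
have Pv : P = v%:R := Zmod_nat P.
case: (ltnP v m) => [lt_v|ge_v].
  exists v.*2.-1; first lia.
  left; rewrite /zigzag prednK ?double_gt0 ?lt0n // odd_double doubleK.
  by rewrite ifT ?Pv //; lia.
exists (n - v).*2.-1; first lia.
right; rewrite /zigzag prednK ?double_gt0; last lia.
rewrite odd_double doubleK ifT; last lia.
by rewrite Pv natrB ?Zmod_period ?sub0r ?opprK //; lia.
Qed.

Lemma zigzagO (P : 'Z_n) :
  exists2 j, (j < n.-1)%N &
    (zigzag j = P /\ zigzag j.+1 = 1 - P) \/ (zigzag j = 1 - P /\ zigzag j.+1 = P).
Proof.
have lt_P := Zmod_lt n_gt1 P; set v := (P : nat) in lt_P.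
have Pv : P = v%:R := Zmod_nat P.
have zE j : zigzag j.*2 = - j%:R /\ zigzag j.*2.+1 = j.+1%:R.
  by rewrite /zigzag /= odd_double doubleK.
case: (boolP (0 < v <= m)%N) => [lt_v|ge_v].
  exists v.-1.*2; first lia.
  right; have [-> ->] := zE v.-1; rewrite prednK ?Pv; last lia.
  split=> //; rewrite -[in 1 - _](@prednK v); last lia.
  by rewrite mulrS opprD addrA subrr add0r.
move: Pv; have [->|v0] := eqVneq v 0%N => Pv.
  exists 0%N; first lia.
  by left; have [-> ->] := zE 0%N; rewrite Pv !mulr0n oppr0 addr0.
exists (n - v).*2; first lia.
left; have [-> ->] := zE (n - v)%N.
by rewrite Pv mulrS natrB ?Zmod_period ?sub0r ?opprK //; lia.
Qed.

(** The finite edges of the i-th cycle are those whose ends sum to 2i or 2i + 1, so half the sum of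
    the ends is the index sought. The vertex [None] is joined there to i and i + m. *)
Lemma walecki_cover (x y : option 'Z_n) : x <> y -> exists i : 'I_m,
  cycle_edge k (walecki i) x y \/ cycle_edge k (walecki i) y x.
Proof.
have edge i t : (t < n)%N -> cycle_edge k (walecki i) (walecki i t) (walecki i t.+1).
  by move=> lt_t; exists t; [lia|rewrite modn_small //; lia].
have coverN (z : 'Z_n) : exists i : 'I_m,
    cycle_edge k (walecki i) None (Some z) \/ cycle_edge k (walecki i) (Some z) None.
  have lt_z := Zmod_lt n_gt1 z; have zE := Zmod_nat z; set v := (z : nat) in lt_z zE.
  case: (ltnP v m) => [lt_v|ge_v].
    exists (Ordinal lt_v); left; have := edge v 0%N.
    by rewrite /= /zigzag /= oppr0 addr0 -zE; apply; lia.
  have lt_i : (v - m < m)%N by lia.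
  have zz : zigzag n.-1 = m%:R.
    by rewrite /zigzag prednK ?doubleK ?ifT //; lia.
  exists (Ordinal lt_i); right; exists n.-1.+1; first lia.
  split; first by rewrite /= zz -natrD subnK -?zE.
  have -> : n.-1.+2 = k by lia.
  by rewrite modnn.
case: x y => [x|] [y|] // ne_xy; last first.
  by have [i [E|E]] := coverN x; exists i; [right|left].
have {ne_xy} ne_xy : x != y by apply: contra_notN ne_xy => /eqP->.
set s := (x + y : 'Z_n); have lt_s := Zmod_lt n_gt1 s.
have sE := Zmod_nat s; set v := (s : nat) in lt_s sE.
have lt_i : (v./2 < m)%N by lia.
suff [j lt_j Ej] : exists2 j, (j < n.-1)%N &
    let i := (v./2)%:R in (x = i + zigzag j /\ y = i + zigzag j.+1) \/
                          (y = i + zigzag j /\ x = i + zigzag j.+1).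
  exists (Ordinal lt_i).
  have := edge v./2 j.+1; rewrite /walecki /=.
  by case: Ej => -[-> ->] E; [left|right]; apply: E; lia.
set i := (v./2)%:R; pose P := x - i.
have Dx : x = i + P by rewrite addrC subrK.
have i2 : (v./2.*2)%:R = i + i by rewrite -[v./2.*2]addnn natrD.
have vE := odd_double_half v; case Ov: (odd v) in vE.
  have yE : y = i + (1 - P).
    have -> : y = s - x by rewrite addrC addKr.
    by rewrite sE -vE natrD i2 /P opprB [RHS]addrCA !addrA.
  have [j lt_j] := zigzagO P.
  by case=> [[Ej Ej']|[Ej Ej']]; exists j => //=; rewrite Ej Ej' -yE -Dx; tauto.
have yE : y = i - P.
  have -> : y = s - x by rewrite addrC addKr.
  by rewrite sE -vE natrD i2 /P opprB add0r !addrA.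
have P2 : P != - P by apply: contraNneq ne_xy => EP; rewrite yE -EP -Dx.
have P0 : P != 0 by apply: contraNneq P2 => ->; rewrite oppr0.
have Pm : P != m%:R.
  apply: contraNneq P2 => ->; rewrite -addr_eq0 -natrD -[(m + m)%N]/(addn m m) addnn.
  by rewrite Zmod_period.
have [j lt_j] := zigzagE P0 Pm.
by case=> [[Ej Ej']|[Ej Ej']]; exists j => //=; rewrite Ej Ej' -yE -Dx; tauto.
Qed.

Lemma hamiltonian_decomposition : exists f : 'I_m -> nat -> 'Z_k,
  [/\ forall i, {in gtn k &, injective (f i)},
      forall x y, x <> y -> exists i,
        cycle_edge k (f i) x y \/ cycle_edge k (f i) y x
    & forall (i : 'I_m) j, i = 0%N :> nat -> (j < k)%N -> f i j = j%:R].
Proof.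
pose h (x : 'Z_k) := walecki 0 x.
have h_inj : injective h.
  by move=> x y /(walecki_inj (Zmod_lt k_gt1 x) (Zmod_lt k_gt1 y)) /val_inj.
have [g hg gh] : bijective h.
  by apply: inj_card_bij => //; rewrite card_option !card_Zmod.
exists (fun i t => g (walecki i t)); split.
- by move=> i s t lt_s lt_t /(can_inj gh); apply: walecki_inj.
- move=> x y ne_xy; have ne_h : h x <> h y by move/h_inj.
  have [i Ei] := walecki_cover ne_h; exists i.
  by case: Ei => -[t lt_t [ht ht']]; [left|right]; exists t => //;
     rewrite -ht -ht' !hg.
move=> i j -> lt_j; rewrite -[RHS]hg /h; congr (g (walecki _ _)).
by rewrite /= val_Zp_nat // modn_small.
Qed.

End Walecki.

(* A vertex of [inner k] is ((level, position), copy): two copies of the base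
   vertex set made of two levels of k positions each. *)
Notation inner k := ((bool * 'Z_k) * bool)%type.

(** * The gadget joining the two levels and the outer vertices *)

Section PairGadget.

Variables (H N' : nat) (om : bool).

Local Notation N := N'.+1.
Local Notation h := H.*2.+1.
Local Notation k := (h + N.*2).

Hypothesis om_H : om -> H = 0.

Variables (Y : Type) (g : bool * 'I_N -> Y) (z : Y).
Hypotheses (g_inj : injective g) (g_z : om -> forall w, g w <> z).

Let k_gt0 : 0 < k. Proof. by []. Qed.
Let k_gt1 : 1 < k. Proof. lia. Qed.

(** Labels of one base sun, from which 2k suns arise by rotating the positions and exchanging the
    copies. Rotations fix the outer vertices; [Extra] is fixed by the exchange as well. *)
Inductive symbol := Inner of bool & bool & nat | Outer of bool & nat | Extra.

Definition valid_symbol s := match s with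
  | Inner _ _ p => p < k | Outer _ q => q < N | Extra => om end.

Definition eval_symbol (e : bool) (t : 'Z_k) s
    : inner k + Y :=
  match s with
  | Inner l b p => inl ((l, (t + p%:R)%R), e (+) b)
  | Outer b q => inr (g (e (+) b, inord q))
  | Extra => inr z
  end.

Lemma eval_symbol_inj e t s s' : valid_symbol s -> valid_symbol s' ->
  eval_symbol e t s = eval_symbol e t s' -> s = s'.
Proof.
case: s s' => [l b p|b q|] [l' b' p'|b' q'|] //=.
  - move=> lt_p lt_p' E0; have E := inl_inj E0; have /= -> := congr1 (fun u => u.1.1) E.
  have /addbI -> := congr1 snd E; congr (Inner _ _ _).
  by apply: (Zmod_nat_inj k_gt1 lt_p lt_p'); have /addrI := congr1 (fun u => u.1.2) E.
- move=> lt_q lt_q' E0; have E := g_inj (inr_inj E0).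
  have /addbI -> := congr1 fst E.
  by have := congr1 (fun u => val u.2) E; rewrite /= !inordK // => ->.
- by move=> _ /g_z gz E0; case: (gz _ (inr_inj E0)).
by move=> /g_z gz _ E0; case: (gz _ (esym (inr_inj E0))).
Qed.

Definition flip j := ~~ odd N && (j == N').

Definition slot j :=
  if odd N then j else if j == N' then N'.-1 else if j.+1 == N' then N' else j.

(* The base cycle zigzags between the levels, realising the differences
   0, ..., h - 1, and then alternates between outer vertices and spokes, which
   are inner vertices whose position is their index. Every outer vertex has to
   meet both levels in both copies; for N odd the alternation of the levels of
   the spokes takes care of this, for N even the last spoke is moved to the other
   copy ([flip]) and the outer leaves of the last two spokes are exchanged
   ([slot]). *)
Definition cycle_symbol i :=
  if i <= h then
    if odd i then Inner true false (H.*2 - i./2) else Inner false false i./2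
  else if odd i then Inner (~~ odd (i - h)./2) (flip (i - h)./2) i
  else Outer false (i - h)./2.

(** On the zigzag the leaf is the other copy of the next cycle vertex, so each difference occurs
    both within a copy and across the copies. With [om] the only such leaf, at i = 0, is given up
    for [Extra]. *)
Definition leaf_symbol i :=
  if i < h then
    if om && (i == 0) then Extra
    else if odd i then Inner false true (i./2).+1 else Inner true true (H.*2 - i./2)
  else if odd i then Outer true (slot (i - h)./2)
  else let J := ((i - h)./2).+1 in
    Inner (~~ odd J || (~~ odd N && (J == N'))) (odd N || (J != N)) i.

Lemma slot_lt j : j < N -> slot j < N.
Proof. by rewrite /slot; do !case: ifP => ?; lia. Qed.

Lemma slotK j : j < N -> slot (slot j) = j.
Proof.
move=> lt_j; rewrite /slot; case: (boolP (odd N)) => // oN.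
by case: (j =P N') => ?; [|case: (j.+1 =P N') => ?]; do !case: ifP => ?; lia.
Qed.

Lemma valid_cycle i : i < k -> valid_symbol (cycle_symbol i).
Proof. by rewrite /cycle_symbol; do !case: ifP => ? //=; lia. Qed.

Lemma valid_leaf i : i < k -> valid_symbol (leaf_symbol i).
Proof.
rewrite /leaf_symbol => lt_ik; do !case: ifP => ? //=; try lia.
apply: slot_lt; lia.
Qed.

Definition symbol_pos s := match s with Inner _ _ p => p | Outer _ q => q | Extra => 0 end.

Lemma symbol_labelling : sun_labelling k cycle_symbol leaf_symbol.
Proof.
split=> i j; rewrite ?inE => lt_i lt_j.
- by rewrite /cycle_symbol; do !case: ifP => ? //; move=> /(congr1 symbol_pos) /=; lia.
- rewrite /leaf_symbol; case: (ltnP i h) => ?; case: (ltnP j h) => ?.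
  + by do !case: ifP => ? //; move=> /(congr1 symbol_pos) /=; lia.
  + by do !case: ifP => ? //; move=> /(congr1 symbol_pos) /=; lia.
  + by do !case: ifP => ? //; move=> /(congr1 symbol_pos) /=; lia.
  case: (boolP (odd i)) => oi; case: (boolP (odd j)) => oj //= /(congr1 symbol_pos) //= E.
  by have := congr1 slot E; rewrite !slotK; lia.
by rewrite /cycle_symbol /leaf_symbol; do !case: ifP => ? //; move=> /(congr1 symbol_pos) /=; lia.
Qed.

(** Spoke 0 is the last vertex of the zigzag, hence the position [H]. *)
Definition spoke_pos j := if j == 0 then H else h + j.*2.

Lemma cycle_spoke j : j < N ->
  cycle_symbol (h + j.*2) = Inner (~~ odd j) (flip j) (spoke_pos j).
Proof.
move=> lt_j; rewrite /cycle_symbol /spoke_pos /flip; case: (j =P 0) => [->|/eqP j0].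
  have -> : (h + 0.*2 <= h) = true by lia.
  have -> : odd (h + 0.*2) = true by lia.
  by congr (Inner _ _ _); lia.
have -> : (h + j.*2 <= h) = false by lia.
have -> : odd (h + j.*2) = true by lia.
by congr (Inner _ _ _); lia.
Qed.

Lemma cycle_outer q : q < N -> cycle_symbol (h + q.*2).+1 = Outer false q.
Proof.
move=> lt_q; rewrite /cycle_symbol; do !case: ifP => ?; try lia.
by congr (Outer _ _); lia.
Qed.

(** The four combinations of level and relative copy come from the two cycle neighbours of the outer
    vertex, from its own leaf, and from the spoke that has its other copy as leaf. *)
Lemma outer_adj q l b : q < N -> exists f b' p,
  f (+) b' = b /\ sun_adj k cycle_symbol leaf_symbol (Outer f q) (Inner l b' p).
Proof.
move=> lt_q.
have prevP : sun_adj k cycle_symbol leaf_symbol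
    (Outer false q) (Inner (~~ odd q) (flip q) (spoke_pos q)).
  rewrite -cycle_outer // -cycle_spoke //; apply: sun_adjC.
  by apply: sun_adj_next; lia.
have nextP : sun_adj k cycle_symbol leaf_symbol (Outer false q)
    (if q.+1 < N then Inner (odd q) (flip q.+1) (spoke_pos q.+1)
     else Inner false false 0).
  rewrite -cycle_outer //; case: ltnP => [lt_q1|ge_q1].
    have <- : cycle_symbol (h + q.*2).+2 = Inner (odd q) (flip q.+1) (spoke_pos q.+1).
      have -> : (h + q.*2).+2 = h + (q.+1).*2 by lia.
      by rewrite (cycle_spoke lt_q1) /= negbK.
    by apply: sun_adj_next; lia.
  have -> : (h + q.*2).+1 = k.-1 by lia.
  have -> : Inner false false 0 = cycle_symbol 0 by [].
  exact: sun_adj_close.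
have leafP : sun_adj k cycle_symbol leaf_symbol (Outer false q)
    (Inner (~~ odd q.+1 || (~~ odd N && (q.+1 == N')))
           (odd N || (q.+1 != N)) (h + q.*2).+1).
  rewrite -(cycle_outer lt_q).
  have <- : leaf_symbol (h + q.*2).+1 =
      Inner (~~ odd q.+1 || (~~ odd N && (q.+1 == N')))
            (odd N || (q.+1 != N)) (h + q.*2).+1.
    rewrite /leaf_symbol; do !case: ifP => ?; try lia.
    by have -> : ((h + q.*2).+1 - h)./2 = q by lia.
  by apply: sun_adj_leaf; lia.
have slotP : sun_adj k cycle_symbol leaf_symbol (Outer true q)
    (Inner (~~ odd (slot q)) (flip (slot q)) (spoke_pos (slot q))).
  have lt_s := slot_lt lt_q; rewrite -cycle_spoke //; apply: sun_adjC.
  have <- : leaf_symbol (h + (slot q).*2) = Outer true q.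
    rewrite /leaf_symbol; do !case: ifP => ?; try lia.
    have -> : (h + (slot q).*2 - h)./2 = slot q by lia.
    by rewrite slotK.
  by apply: sun_adj_leaf; lia.
have [|||] : [\/ l = ~~ odd q /\ b = flip q,
    if q.+1 < N then l = odd q /\ b = flip q.+1 else l = false /\ b = false,
    l = (~~ odd q.+1 || (~~ odd N && (q.+1 == N'))) /\ b = (odd N || (q.+1 != N))
  | l = ~~ odd (slot q) /\ b = ~~ flip (slot q)].
- suff : (l == ~~ odd q) && (b == flip q) ||
    (if q.+1 < N then (l == odd q) && (b == flip q.+1) else ~~ l && ~~ b) ||
    (l == (~~ odd q.+1 || (~~ odd N && (q.+1 == N')))) && (b == (odd N || (q.+1 != N))) ||
    (l == ~~ odd (slot q)) && (b == ~~ flip (slot q)).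
    case/orP=> [/orP[/orP[/andP[/eqP-> /eqP->]|]|/andP[/eqP-> /eqP->]]|/andP[/eqP-> /eqP->]].
    + by constructor 1.
    + case: ifP => _; first by case/andP=> /eqP-> /eqP->; constructor 2.
      by case/andP=> /negPf-> /negPf->; constructor 2.
    + by constructor 3.
    + by constructor 4.
  rewrite /slot /flip; case: (boolP (odd N)) => oN; case: ltnP => ?;
    do ?case: ifP => ?; case: l; case: b; lia.
- by case=> -> ->; exists false, (flip q), (spoke_pos q).
- case: ifP nextP => _ nextP [-> ->].
    by exists false, (flip q.+1), (spoke_pos q.+1).
  by exists false, false, 0.
- case=> -> ->; exists false, (odd N || (q.+1 != N)), (h + q.*2).+1.
  by [].
case=> -> ->; exists true, (flip (slot q)), (spoke_pos (slot q)).
by [].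
Qed.

Lemma cover_pair_gadget :
  sun_cover k (fun x y : inner k + Y =>
    [\/ exists p d b b', [/\ d < h, om -> b = b',
          x = inl ((false, p), b) & y = inl ((true, (p + d%:R)%R), b')],
        exists u w, x = inl u /\ y = inr (g w)
      | om /\ exists p b, x = inl ((false, p), b) /\ y = inr z]) k.*2.
Proof.
exists (bool * 'Z_k)%type, (fun s i => eval_symbol s.1 s.2 (cycle_symbol i)),
  (fun s i => eval_symbol s.1 s.2 (leaf_symbol i)).
have [c_inj l_inj cl] := symbol_labelling.
split; first by rewrite card_prod card_bool card_Zmod // mul2n.
  move=> [e t]; split=> i j lt_i lt_j /=.
  - move/(eval_symbol_inj (valid_cycle lt_i) (valid_cycle lt_j)).
    exact: c_inj.
  - move/(eval_symbol_inj (valid_leaf lt_i) (valid_leaf lt_j)).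
    exact: l_inj.
  - move/(eval_symbol_inj (valid_cycle lt_i) (valid_leaf lt_j)).
    exact: cl.
have adj_eval e t s s' : sun_adj k cycle_symbol leaf_symbol s s' ->
    sun_adj k (fun i => eval_symbol e t (cycle_symbol i))
      (fun i => eval_symbol e t (leaf_symbol i)) (eval_symbol e t s) (eval_symbol e t s').
  by case=> [] [i lti [-> [] ->]]; [left|left|right|right]; exists i => //;
     split=> //; [left|right|left|right].
have cover_mixed s s' b b' c c' l l' (p p' : 'Z_k) j j' :
    sun_adj k cycle_symbol leaf_symbol s s' ->
    s = Inner l c j -> s' = Inner l' c' j' ->
    b (+) c = b' (+) c' -> (p - j%:R = p' - j'%:R)%R ->
    exists t : bool * 'Z_k, sun_adj k (fun i => eval_symbol t.1 t.2 (cycle_symbol i))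
      (fun i => eval_symbol t.1 t.2 (leaf_symbol i))
      (inl ((l, p), b)) (inl ((l', p'), b')).
  move=> adj_s Es Es' bc pj; exists (b (+) c, (p - j%:R)%R).
  have := adj_eval (b (+) c) (p - j%:R)%R _ _ adj_s; rewrite Es Es' /= subrK.
  by rewrite pj subrK -addbA addbb addbF bc -addbA addbb addbF.
move=> x y [[p [d [b [b' [lt_d omb -> ->]]]]]|[[[l p] b] [[b' q] [-> ->]]]|].
(* The i-th step of the zigzag has difference 2H - i. *)
- set i := H.*2 - d; have lt_i : i < h by lia.
  have lt_i1 : i.+1 < k by lia.
  have adj1 : sun_adj k cycle_symbol leaf_symbol (cycle_symbol i) (cycle_symbol i.+1).
    exact: sun_adj_next.
  have adj2 : sun_adj k cycle_symbol leaf_symbol (cycle_symbol i) (leaf_symbol i).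
    by apply: sun_adj_leaf; apply: ltnW.
  case: (boolP (odd i)) => oi.
    have Ec : cycle_symbol i = Inner true false (H.*2 - i./2).
      by rewrite /cycle_symbol oi ltnW.
    have Ec' : cycle_symbol i.+1 = Inner false false (i./2).+1.
      by rewrite /cycle_symbol lt_i /= oi; congr (Inner _ _ _); lia.
    have El : leaf_symbol i = Inner false true (i./2).+1.
      rewrite /leaf_symbol lt_i oi; case: (i =P 0) => [i0|_]; last by rewrite andbF.
      by move: oi; rewrite i0.
    have pd : (p + d%:R - (H.*2 - i./2)%:R = p - (i./2).+1%:R :> 'Z_k)%R.
      apply/eqP; rewrite subr_eq addrAC eq_sym subr_eq -!addrA -!natrD.
      by apply/eqP; congr (_ + _%:R)%R; lia.
    case: (eqVneq b b') => [Eb|nb].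
      have bb : b' (+) false = b (+) false by rewrite Eb.
      have [t adj_t] := cover_mixed _ _ b' b _ _ _ _ _ _ _ _ adj1 Ec Ec' bb pd.
      by exists t; apply: sun_adjC.
    have bb : b' (+) false = b (+) true by case: (b) (b') nb => [] [].
    have [t adj_t] := cover_mixed _ _ b' b _ _ _ _ _ _ _ _ adj2 Ec El bb pd.
    by exists t; apply: sun_adjC.
  have Ec : cycle_symbol i = Inner false false i./2.
    by rewrite /cycle_symbol (negPf oi) ltnW.
  have Ec' : cycle_symbol i.+1 = Inner true false (H.*2 - i./2).
    by rewrite /cycle_symbol lt_i /= oi; congr (Inner _ _ _); lia.
  have pd : (p - (i./2)%:R = p + d%:R - (H.*2 - i./2)%:R :> 'Z_k)%R.
    apply/eqP; rewrite subr_eq addrAC eq_sym subr_eq -!addrA -!natrD.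
    by apply/eqP; congr (_ + _%:R)%R; lia.
  case: (eqVneq b b') => [Eb|nb].
    have bb : b (+) false = b' (+) false by rewrite Eb.
    have [t adj_t] := cover_mixed _ _ b b' _ _ _ _ _ _ _ _ adj1 Ec Ec' bb pd.
    by exists t.
  have om0 : om = false by apply/negbTE/negP => /omb Eb; rewrite Eb eqxx in nb.
  have El : leaf_symbol i = Inner true true (H.*2 - i./2).
    by rewrite /leaf_symbol lt_i (negPf oi) om0.
  have bb : b (+) false = b' (+) true by case: (b) (b') nb => [] [].
  have [t adj_t] := cover_mixed _ _ b b' _ _ _ _ _ _ _ _ adj2 Ec El bb pd.
  by exists t.
- have [f [c [j [fc adj]]]] := outer_adj l (b' (+) b) (ltn_ord q).
  exists (b (+) c, (p - j%:R)%R).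
  have := adj_eval (b (+) c) (p - j%:R)%R _ _ (sun_adjC adj).
  rewrite /= subrK -addbA addbb addbF inord_val.
  by have -> : b (+) c (+) f = b' by move: fc; case: (b) (c) (f) (b') => [] [] [] [].
case=> Om [p [b [-> ->]]]; have H0 := om_H Om.
have adj : sun_adj k cycle_symbol leaf_symbol (cycle_symbol 0) (leaf_symbol 0).
  exact: sun_adj_leaf.
exists (b, p); have := adj_eval b p _ _ adj.
by rewrite /leaf_symbol Om /= addr0 addbF.
Qed.

End PairGadget.

(** * Sharing the differences among gadgets *)

Section Spread.

Variable k : nat.
Hypothesis k_gt2 : 2 < k.

Definition mixed_edge (d0 d : nat) (x y : inner k) : Prop :=
  exists p e b b', [/\ d0 <= e < d, x = ((false, p), b)
    & y = ((true, (p + e%:R)%R), b')].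

Definition unit_edge (x y : inner k) : Prop :=
  exists p b b', x = ((false, p), b) /\ y = ((false, (p + 1)%R), b').

Definition spread_edge (pd : bool) (d : nat) (X : Type) (x y : inner k + X) : Prop :=
  (exists u v, [/\ mixed_edge 0 d u v \/ pd /\ unit_edge u v, x = inl u & y = inl v]) \/
  (exists u w, x = inl u /\ y = inr w).

(** The part of the hole left to gadgets. All instances built below have n = 2(d + r), or 2(d + r +
    1) with [pd], since the unit steps weigh as much as one difference. *)
Definition spread (pd : bool) (d r n : nat) : Prop :=
  sun_cover k (@spread_edge pd d 'I_r) n.

Lemma spread_of_card (X : finType) pd d n :
  sun_cover k (@spread_edge pd d X) n -> spread pd d #|X| n.
Proof.
pose f (x : inner k + X) : inner k + 'I_#|X| :=
  match x with inl u => inl u | inr w => inr (enum_rank w) end.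
have f_inj : injective f.
  move=> [u|w] [u'|w'] // E; first by have -> := inl_inj E.
  by have /enum_rank_inj -> := inr_inj E.
move=> cov; apply: (sun_cover_map f_inj cov).
move=> x y [[u [v [uv -> ->]]]|[u [w [-> ->]]]].
  by exists (inl u), (inl v); split=> //; left; left; exists u, v.
exists (inl u), (inr (enum_val w)); split=> //; first by rewrite /= enum_valK.
by left; right; exists u, (enum_val w).
Qed.

Lemma spread_empty : spread false 0 0 0.
Proof.
exists void, (@of_void _), (@of_void _); split=> [|[]|x y] //; first by rewrite card_void.
by case=> [[u [v [[[p [e [b [b' []]]]]|[]]]]]|[u [[]]]].
Qed.

(** Shifting level [true] by [d1] turns the differences 0, ..., d2 - 1 of the second family into the
    next [d2] ones. *)
Lemma spread_add pd d1 r1 n1 d2 r2 n2 :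
  spread pd d1 r1 n1 -> spread false d2 r2 n2 -> spread pd (d1 + d2) (r1 + r2) (n1 + n2).
Proof.
move=> cov1 cov2.
pose f1 (x : inner k + 'I_r1) : inner k + ('I_r1 + 'I_r2) :=
  match x with inl u => inl u | inr w => inr (inl w) end.
pose sh (u : inner k) : inner k :=
  ((u.1.1, if u.1.1 then (u.1.2 + d1%:R)%R else u.1.2), u.2).
pose f2 (x : inner k + 'I_r2) : inner k + ('I_r1 + 'I_r2) :=
  match x with inl u => inl (sh u) | inr w => inr (inr w) end.
have sh_inj : injective sh.
  move=> [[l p] b] [[l' p'] b'] E; have /= El := congr1 (fun u => u.1.1) E.
  have /= -> := congr1 snd E; subst l'; congr (_, _, _).
  by have /= := congr1 (fun u => u.1.2) E; case: ifP => _ // /addIr.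
have f1_inj : injective f1.
  by move=> [u|w] [u'|w'] // E; [have -> := inl_inj E|have -> := inl_inj (inr_inj E)].
have f2_inj : injective f2.
  by move=> [u|w] [u'|w'] // E; [have /sh_inj -> := inl_inj E|have -> := inr_inj (inr_inj E)].
have sh_onto u : exists u', u = sh u'.
  case: u => [[l p] b]; exists ((l, if l then (p - d1%:R)%R else p), b).
  by rewrite /sh /=; case: l; rewrite ?subrK.
have := @spread_of_card ('I_r1 + 'I_r2)%type pd (d1 + d2) (n1 + n2).
rewrite card_sum !card_ord; apply.
apply: (@sun_coverS _ _
  (fun x y => (exists u v, [/\ spread_edge pd d1 u v, x = f1 u & y = f1 v]) \/
              (exists u v, [/\ spread_edge false d2 u v, x = f2 u & y = f2 v]))); last first.
  apply: sun_coverU.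
    apply: (sun_cover_map f1_inj cov1) => x y [u [v [uv -> ->]]].
    by exists u, v; split=> //; left.
  apply: (sun_cover_map f2_inj cov2) => x y [u [v [uv -> ->]]].
  by exists u, v; split=> //; left.
move=> x y [[u [v [[[p [e [b [b' [lt_e Eu Ev]]]]]|uv] -> ->]]]|[u [[w|w] [-> ->]]]].
- case: (ltnP e d1) => [lt_e1|ge_e1].
    left; exists (inl u), (inl v); split=> //; left; exists u, v; split=> //.
    by left; exists p, e, b, b'.
  right; exists (inl u), (inl ((true, (p + (e - d1)%:R)%R), b')); split.
  + left; exists u, ((true, (p + (e - d1)%:R)%R), b'); split=> //.
    by left; exists p, (e - d1), b, b'; split=> //; lia.
  + by rewrite Eu.
  by rewrite Ev /= /sh /= -addrA -natrD subnK.
- by left; exists (inl u), (inl v); split=> //; left; exists u, v; split=> //; right.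
- by left; exists (inl u), (inr w); split=> //; right; exists u, w.
have [u' ->] := sh_onto u.
by right; exists (inl u'), (inr w); split=> //; right; exists u', w.
Qed.

Lemma spread_mul a d r n : spread false d r n -> spread false (a * d) (a * r) (a * n).
Proof.
move=> cov; elim: a => [|a IHa]; first exact: spread_empty.
rewrite !mulSn; exact: spread_add.
Qed.

Hypothesis k_odd : odd k.

Lemma spread_block h : odd h -> h + 2 <= k -> spread false h (k - h) k.*2.
Proof.
move=> h_odd le_hk.
have [H hE] : exists H, h = H.*2.+1 by exists h./2; lia.
have [N' kE] : exists N', k = H.*2.+1 + N'.+1.*2 by exists ((k - h)./2).-1; lia.
have := @spread_of_card (bool * 'I_N'.+1)%type false h k.*2.
rewrite card_prod card_bool card_ord.
have -> : 2 * N'.+1 = k - h by lia.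
apply.
have cov := @cover_pair_gadget H N' false _ (bool * 'I_N'.+1)%type id (false, ord0).
rewrite -kE -hE in cov.
apply: sun_coverS (cov _ _ _) => // x y.
move=> [[u [v [[[p [e [b [b' [lt_e -> ->]]]]]|[]//] -> ->]]]|[u [w [-> ->]]]].
  by constructor 1; exists p, e, b, b'.
by constructor 2; exists u, w.
Qed.

(* Two gadgets with h = 1 share an outer vertex, for which each gives up its only
   mixed leaf edge; the second one is relabelled so as to cover the half of the
   difference 0 that the first one misses. *)
Lemma spread_twin : spread false 1 (k.*2 - 1) (4 * k).
Proof.
have [N' kE] : exists N', k = 1 + N'.+1.*2 by exists k./2.-1; lia.
pose W := (bool * 'I_N'.+1)%type.
have := @spread_of_card (option (W + W)) false 1 (4 * k).
rewrite card_option card_sum card_prod card_bool card_ord.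
have -> : (2 * N'.+1 + 2 * N'.+1).+1 = k.*2 - 1 by lia.
apply.
have cov1 := @cover_pair_gadget 0 N' true _ (option (W + W)) (fun w => Some (inl w)) None.
have cov2 := @cover_pair_gadget 0 N' true _ (option (W + W)) (fun w => Some (inr w)) None.
rewrite -[0.*2.+1]/1 -kE in cov1 cov2.
(* Exchanges the levels, and the copies on one of them: edges of difference 0 within a copy become
   edges across, and the shared vertex gets joined to the level that the first gadget does not join
   it to. *)
pose sw (u : inner k) : inner k := ((~~ u.1.1, u.1.2), u.1.1 == u.2).
have sw_inj : injective sw.
  move=> [[l p] b] [[l' p'] b'] E; have /= /negb_inj El := congr1 (fun u => u.1.1) E.
  have /= -> := congr1 (fun u => u.1.2) E; subst l'.
  by have := congr1 snd E; rewrite /= {E}; case: l; case: b; case: b'.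
have sw_onto u : exists u', u = sw u'.
  case: u => [[l p] b]; exists ((~~ l, p), ~~ l == b).
  by rewrite /sw /= negbK; case: l; case: b.
pose f (x : inner k + option (W + W)) : inner k + option (W + W) :=
  match x with inl u => inl (sw u) | inr w => inr w end.
have f_inj : injective f.
  by move=> [u|w] [u'|w'] // E; have /sw_inj -> := inl_inj E.
have -> : 4 * k = k.*2 + k.*2 by lia.
have inj1 : injective (fun w : W => Some (@inl W W w)) by move=> w w' [].
have inj2 : injective (fun w : W => Some (@inr W W w)) by move=> w w' [].
have {}cov1 := cov1 (fun=> erefl) inj1.
have {}cov2 := cov2 (fun=> erefl) inj2.
have ne1 (w : W) : Some (@inl W W w) <> None by [].
have ne2 (w : W) : Some (@inr W W w) <> None by [].
have {}cov1 := cov1 (fun=> ne1); have {}cov2 := cov2 (fun=> ne2).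
set E1 := (X in sun_cover _ X _) in cov1; set E2 := (X in sun_cover _ X _) in cov2.
pose E2' x y := exists u v, [/\ x = f u, y = f v & E2 u v \/ E2 v u].
have {}cov2 : sun_cover k E2' k.*2 by apply: (sun_cover_map f_inj cov2).
apply: sun_coverS (sun_coverU cov1 cov2) => x y.
case=> [[u [v [[[p [e [b [b' [lt_e -> ->]]]]]|[]//] -> ->]]]|[u [[[w|w]|] [-> ->]]]].
- have -> : e = 0 by lia.
  case: (eqVneq b b') => [Eb|nb].
    by left; constructor 1; exists p, 0, b, b'.
  right; exists (inl ((true, p), b)), (inl ((false, p), b)); split.
  + by rewrite /f /sw /=; case: (b) (b') nb => [] [].
  + by rewrite /f /sw /= addr0; case: (b) (b') nb => [] [].
  by right; constructor 1; exists p, 0, b, b; rewrite addr0.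
- by left; constructor 2; exists u, w.
- have [u' ->] := sw_onto u; right; exists (inl u'), (inr (Some (inr w))); split=> //.
  by left; constructor 2; exists u', w.
case: u => [[[] p] b]; last by left; constructor 3; split=> //; exists p, b.
right; exists (inl ((false, p), ~~ b)), (inr None); split=> //.
  by rewrite /f /sw /=; case: b.
by left; constructor 3; split=> //; exists p, (~~ b).
Qed.

(** A gadget alone takes an odd number of differences, a twin pair makes do with one; hence G <= 2d.
    In [combine], x twin pairs, y gadgets with one difference each and, unless h = 0, one with h of
    them share out the d differences. For G <= d a single gadget takes the surplus, and a twin pair
    repairs the parity if d - G is odd; G > 2 leaves room for that pair and keeps h + 2 <= k. *)
Lemma spread_staircase d G : 2 < G <= d.*2 -> d < k -> spread false d (k * G - d) (2 * k * G).
Proof.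
move=> G_bounds lt_dk.
have combine x y h : (h == 0) || odd h && (h + 2 <= k) ->
    x + y + h = d -> x.*2 + y + (h != 0) = G ->
    spread false d (k * G - d) (2 * k * G).
  move=> h_ok hd hG.
  have big : spread false h (if h == 0 then 0 else k - h) (if h == 0 then 0 else k.*2).
    case: eqP h_ok => [->|_] /=; first by move=> _; exact: spread_empty.
    by case/andP; apply: spread_block.
  have one : spread false 1 (k - 1) k.*2 by apply: spread_block => //; lia.
  have := spread_add (spread_add (spread_mul x spread_twin) (spread_mul y one)) big.
  have -> : x * 1 + y * 1 + h = d by lia.
  congr (spread _ _ _ _); rewrite -?hd -hG; case: eqP h_ok => [->|_] /= ?; nia.
case: (ltnP d G) => ?.
  by apply: (combine (G - d) (d.*2 - G) 0) => //; lia.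
pose x := odd (d - G) : nat.
apply: (combine x (G - 1 - x.*2) (d - G + 1 + x)); rewrite /x; lia.
Qed.

End Spread.

(** * The gadget with unit steps *)

Section PureGadget.

Variable k : nat.
Hypothesis k_gt2 : 2 < k.

(* The suns double the translates of a base cycle that zigzags between the
   levels, makes a unit step on level [false] and then alternates between outer
   and inner vertices. *)
Lemma spread_pure g N' : ~~ odd N'.+1 -> k = 1 + g.*2 + N'.+1.*2 ->
  spread k true g.*2 N'.+1.*2 k.*2.
Proof.
move=> N_even kE.
have k_gt0 : 0 < k by lia.
have k_gt1 : 1 < k by lia.
pose inf_pos i := (i - g.*2.+2)./2.
pose c (t : 'Z_k) i : bool * 'Z_k + 'I_N'.+1 :=
  if i <= g.*2 then
    if odd i then inl (true, (t + (g.*2 - 1 - i./2)%:R)%R) else inl (false, (t + (i./2)%:R)%R)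
  else if i == g.*2.+1 then inl (false, (t + g.+1%:R)%R)
  else if odd (i - g.*2.+2) then inl (~~ odd (inf_pos i), (t + i%:R)%R)
  else inr (inord (inf_pos i)).
have c_inj t : {in gtn k &, injective (c t)}.
  have inlE l p l' p' : inl (l, (t + p%:R)%R) = inl (l', (t + p'%:R)%R) :> bool * 'Z_k + 'I_N'.+1 ->
      p < k -> p' < k -> l = l' /\ p = p'.
    move=> E0 lt_p lt_p'; have E := inl_inj E0; have /= -> := congr1 fst E; split=> //.
    by apply: (Zmod_nat_inj k_gt1 lt_p lt_p'); have /addrI := congr1 snd E.
  move=> i j; rewrite !inE /c /inf_pos => lt_i lt_j.
  do !case: ifP => ? //; try (by move/inlE => H; have := H ltac:(lia) ltac:(lia); lia).
  move=> E0; have E := congr1 val (inr_inj E0); move: E; rewrite /= !inordK; lia.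
have cov := sun_cover_big (fun t : 'Z_k => cover_double_cycle k_gt2 (c_inj t)).
rewrite sum_nat_const card_Zmod // muln2 in cov.
pose f (x : (bool * 'Z_k + 'I_N'.+1) * bool) : inner k + 'I_N'.+1 * bool :=
  match x.1 with inl u => inl (u, x.2) | inr q => inr (q, x.2) end.
have f_inj : injective f.
  move=> [[u|q] b] [[u'|q'] b'] //= E0.
    by have E := inl_inj E0; have /= -> := congr1 fst E; have /= -> := congr1 snd E.
  by have E := inr_inj E0; have /= -> := congr1 fst E; have /= -> := congr1 snd E.
have := @spread_of_card k ('I_N'.+1 * bool)%type true g.*2 k.*2.
rewrite card_prod card_bool card_ord muln2; apply.
have edge t i : i.+1 < k -> cycle_edge k (c t) (c t i) (c t i.+1).
  by move=> lt_i; exists i; [exact: ltnW | rewrite modn_small].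
have edge_close t : cycle_edge k (c t) (c t k.-1) (c t 0).
  by exists k.-1; rewrite ?prednK // modnn.
apply: (sun_cover_map f_inj cov) => x y.
case=> [[u [v [[[p [e [b [b' [lt_e -> ->]]]]]|[_ [p [b [b' [-> ->]]]]]] -> ->]]]|[u [w [-> ->]]]].
- pose i := g.*2 - 1 - e; case: (boolP (odd e)) => oe.
    have Ec : c (p - (i./2)%:R)%R i = inl (false, p).
      rewrite /c; do !case: ifP => ?; try (exfalso; lia).
      by rewrite subrK.
    have Ec' : c (p - (i./2)%:R)%R i.+1 = inl (true, p + e%:R)%R.
      rewrite /c; do !case: ifP => ?; try (exfalso; lia).
      have -> : g.*2 - 1 - i.+1./2 = i./2 + e by lia.
      by rewrite natrD addrA subrK.
    exists (inl (false, p), b), (inl (true, p + e%:R)%R, b'); split=> //; left.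
    by exists (p - (i./2)%:R)%R; rewrite /= -Ec -Ec'; apply: edge; lia.
  have Ec' : c (p - (i.+1./2)%:R)%R i.+1 = inl (false, p).
    rewrite /c; do !case: ifP => ?; try (exfalso; lia).
    by rewrite subrK.
  have Ec : c (p - (i.+1./2)%:R)%R i = inl (true, p + e%:R)%R.
    rewrite /c; do !case: ifP => ?; try (exfalso; lia).
    have -> : g.*2 - 1 - i./2 = i.+1./2 + e by lia.
    by rewrite natrD addrA subrK.
  exists (inl (false, p), b), (inl (true, p + e%:R)%R, b'); split=> //; right.
  by exists (p - (i.+1./2)%:R)%R; rewrite /= -Ec' -Ec; apply: edge; lia.
- have Ec : c (p - g%:R)%R g.*2 = inl (false, p).
    rewrite /c; do !case: ifP => ?; try (exfalso; lia).
    have -> : g.*2./2 = g by lia.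
    by rewrite subrK.
  have Ec' : c (p - g%:R)%R g.*2.+1 = inl (false, p + 1)%R.
    rewrite /c; do !case: ifP => ?; try (exfalso; lia).
    by rewrite -[g.+1]addn1 natrD addrA subrK.
  exists (inl (false, p), b), (inl (false, p + 1)%R, b'); split=> //; left.
  by exists (p - g%:R)%R; rewrite /= -Ec -Ec'; apply: edge; lia.
case: u w => [[l p] b] [q b']; have lt_q := ltn_ord q; pose i := g.*2.+2 + q.*2.
have Ei t : c t i = inr q.
  rewrite /c /inf_pos; do !case: ifP => ?; try (exfalso; lia).
  by congr inr; apply: val_inj; rewrite /= inordK; lia.
exists (inl (l, p), b), (inr q, b'); split=> //=.
(* Outer vertex q has its predecessor on level [odd q] and its successor on the other one. For the
   last q the successor is the start of the cycle, on level [false], which is why the number of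
   outer vertices of the cycle is even. *)
have [l_odd|l_even] := eqVneq l (odd q).
  left; suff [j Ej] : exists j : nat, forall t, c t i.-1 = inl (l, t + j%:R)%R.
    exists (p - j%:R)%R; have Et := Ej (p - j%:R)%R; rewrite subrK in Et.
    rewrite /= -Et -(Ei (p - j%:R)%R); have iE : i = i.-1.+1 by lia.
    by rewrite {2}iE; apply: edge; lia.
  case: (posnP q) => q0.
    exists g.+1 => t; rewrite /c; do !case: ifP => ?; try (exfalso; lia).
    by rewrite l_odd q0.
  exists i.-1 => t; rewrite /c /inf_pos; do !case: ifP => ?; try (exfalso; lia).
  by congr (inl (_, _)); rewrite l_odd; lia.
suff [j [i' [Ej Eii]]] : exists j i' : nat, (forall t, c t i' = inl (l, t + j%:R)%R) /\
    forall t, cycle_edge k (c t) (c t i) (c t i').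
  right; exists (p - j%:R)%R; have Et := Ej (p - j%:R)%R; rewrite subrK in Et.
  by rewrite /= -Et -(Ei (p - j%:R)%R).
case: (ltnP i.+1 k) => lt_i.
  exists i.+1, i.+1; split=> t; last exact: edge.
  rewrite /c /inf_pos; do !case: ifP => ?; try (exfalso; lia).
  by congr (inl (_, _)); case: (l) l_even => ?; lia.
exists 0, 0; split=> t; last by have -> : i = k.-1 by lia.
rewrite /c /=; congr (inl (_, _)); case: (l) l_even => //; lia.
Qed.

End PureGadget.

(** * Decomposing the hole on 4k vertices *)

Section Holes.

Variable k : nat.

Definition hole_edge (A X : Type) (x y : A + X) : Prop :=
  x <> y /\ exists u, x = inl u.

(* The count makes the covering a decomposition of K_(n + r) minus K_r. *)
Definition hole (n r : nat) : Prop :=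
  exists2 N, sun_cover k (@hole_edge 'I_n 'I_r) N & N * (4 * k) = n * (n + r.*2 - 1).

Lemma hole_of_card (A X : finType) N :
  sun_cover k (@hole_edge A X) N -> N * (4 * k) = #|A| * (#|A| + #|X|.*2 - 1) ->
  hole #|A| #|X|.
Proof.
move=> cov NE; exists N => //.
pose f (x : A + X) : 'I_#|A| + 'I_#|X| :=
  match x with inl u => inl (enum_rank u) | inr w => inr (enum_rank w) end.
pose g (x : 'I_#|A| + 'I_#|X|) : A + X :=
  match x with inl u => inl (enum_val u) | inr w => inr (enum_val w) end.
have fK : cancel f g by case=> a; rewrite /= enum_rankK.
have gK : cancel g f by case=> a; rewrite /= enum_valK.
apply: (sun_cover_map (can_inj fK) cov) => x y [ne_xy [u xE]].
exists (g x), (g y); rewrite !gK; split=> //; left; split; first by move/(can_inj gK).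
by exists (enum_val u); rewrite xE.
Qed.

Hypothesis k_gt4 : 4 < k.
Hypothesis k_odd : odd k.

Let k_gt2 : 2 < k. Proof. lia. Qed.
Let k_gt1 : 1 < k. Proof. lia. Qed.
Let k_gt0 : 0 < k. Proof. lia. Qed.

(** For k dividing r: the unit steps stand in for a k-th difference, and k differences pay for one
    gadget beyond the G needed for kG outer vertices. The number g, 0 or 1, makes (k - 1)/2 - g
    even, as the gadget with unit steps demands. *)
Lemma spread_full G : 2 < G <= (k - 1 - (odd k./2).*2).*2 ->
  spread k true (k - 1) (k * G) (2 * k * G.+1).
Proof.
move=> G_bounds; pose g := odd k./2 : nat.
have [N' NE] : exists N', k./2 - g = N'.+1 by exists (k./2 - g).-1; rewrite /g; lia.
pose d := k - 1 - g.*2.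
have kE : k = 1 + g.*2 + N'.+1.*2 by lia.
have N_even : ~~ odd N'.+1 by rewrite -NE /g; lia.
have := spread_add k_gt2 (spread_pure k_gt2 N_even kE)
  (spread_staircase k_gt2 k_odd (d := d) G_bounds _).
have -> : g.*2 + d = k - 1 by rewrite /d; lia.
have -> : N'.+1.*2 + (k * G - d) = k * G by rewrite /d; nia.
have -> : k.*2 + 2 * k * G = 2 * k * G.+1 by nia.
by apply; rewrite /d; lia.
Qed.

Let m := k./2.
Let mE : k = m.*2.+1. Proof. rewrite /m; lia. Qed.

Definition level_edge (l : bool) (c : nat -> 'Z_k) (x y : inner k) : Prop :=
  exists p q b b', [/\ x = ((l, p), b), y = ((l, q), b') & cycle_edge k c p q].

Definition vertical_edge (x y : inner k) : Prop := x.1 = y.1 /\ x.2 <> y.2.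

Lemma cover_level l (c : nat -> 'Z_k) : {in gtn k &, injective c} ->
  sun_cover k (level_edge l c) 2.
Proof.
move=> c_inj; apply: sun_coverS (cover_double_cycle (c := fun i => (l, c i)) k_gt2 _).
  move=> x y [p [q [b [b' [-> -> [i lt_i [-> ->]]]]]]].
  by exists i.
by move=> i j lt_i lt_j E; apply: c_inj lt_i lt_j _; exact: (congr1 snd E).
Qed.

Lemma mod_cycle_onto (c : nat -> 'Z_k) p : {in gtn k &, injective c} ->
  exists2 i, i < k & c i = p.
Proof.
move=> c_inj; pose c' (i : 'I_k) := c i.
have c'_inj : injective c' by move=> i j /(c_inj _ _ (ltn_ord i) (ltn_ord j)) /val_inj.
have card_le : #|'Z_k| <= #|'I_k| by rewrite (card_Zmod k_gt1) card_ord.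
have /codomP[i ->] := inj_card_onto c'_inj card_le p.
by exists (val i); first exact: ltn_ord.
Qed.

(** A single difference is a perfect matching between the levels, so it hangs one leaf on every
    vertex of a Hamiltonian cycle of either level. *)
Lemma cover_level_mixed l (c : nat -> 'Z_k) e : {in gtn k &, injective c} ->
  sun_cover k (fun x y => level_edge l c x y \/ mixed_edge e e.+1 x y) 4.
Proof.
move=> c_inj.
pose u i := (~~ l, if l then (c i - e%:R)%R else (c i + e%:R)%R).
have lab : sun_labelling k (fun i => (l, c i)) u.
  split=> [i j lt_i lt_j E|i j lt_i lt_j E|i j _ _ E].
  - by apply: c_inj lt_i lt_j _; exact: (congr1 snd E).
  - by apply: c_inj lt_i lt_j _; have := congr1 snd E; rewrite /u /=; case: (l) => /addIr.
  - by move: (congr1 fst E); rewrite /= {E}; case: (l).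
apply: (sun_cover_map (f := id) _ (cover_double_sun k_gt2 k_odd lab)) => // x y.
case=> [[p [q [b [b' [-> -> [i lt_i [-> ->]]]]]]]|[p [e' [b [b' [He -> ->]]]]]].
  exists ((l, c i), b), ((l, c (i.+1 %% k)), b'); split=> //; left.
  by exists i => //=; split=> //; left.
have -> : e' = e by lia.
exists ((false, p), b), ((true, (p + e%:R)%R), b'); split=> //.
case: (boolP l) => Hl; [right|left].
  have [i lt_i ci] := mod_cycle_onto (p + e%:R)%R c_inj.
  by exists i => //=; rewrite /u ci Hl addrK; split=> //; right.
have [i lt_i ci] := mod_cycle_onto p c_inj.
by exists i => //=; rewrite /u ci (negbTE Hl); split=> //; right.
Qed.

(** The difference k - 1 is -1; the matching it defines links the cycles on the two levels. *)
Lemma cover_linked_levels (c d : nat -> 'Z_k) :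
    {in gtn k &, injective c} -> {in gtn k &, injective d} ->
  sun_cover k (fun x y => [\/ level_edge false c x y, level_edge true d x y,
     mixed_edge (k - 1) k x y | vertical_edge x y]) 7.
Proof.
move=> c_inj d_inj.
pose C i := (false, c i); pose D i := (true, d i).
pose u i := (true, (c i - 1)%R); pose w i := (false, (d i + 1)%R).
have labC : sun_labelling k C u.
  split=> [i j lt_i lt_j E|i j lt_i lt_j E|i j _ _ //].
  - by apply: c_inj lt_i lt_j _; exact: (congr1 snd E).
  - by apply: c_inj lt_i lt_j _; have /= /addIr := congr1 snd E.
have labD : sun_labelling k D w.
  split=> [i j lt_i lt_j E|i j lt_i lt_j E|i j _ _ //].
  - by apply: d_inj lt_i lt_j _; exact: (congr1 snd E).
  - by apply: d_inj lt_i lt_j _; have /= /addIr := congr1 snd E.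
have link i : i < k -> exists2 j, j < k & u i = D j /\ w j = C i.
  move=> lt_i; have [j lt_j dj] := mod_cycle_onto (c i - 1)%R d_inj.
  by exists j => //; rewrite /u /D /w /C dj subrK.
apply: sun_coverS (cover_linked_cycles k_gt2 k_odd labC labD link) => x y.
case=> [[p [q [b [b' [-> -> [i lt_i [-> ->]]]]]]]|
        [p [q [b [b' [-> -> [i lt_i [-> ->]]]]]]]||[xy1 xy2]].
- by left; exists i => //; split=> //; left.
- by right; left; exists i.
- move=> [p [e [b [b' [He -> ->]]]]]; left.
  have [i lt_i ci] := mod_cycle_onto p c_inj; exists i => //=.
  rewrite /C /u ci; split=> //; right; congr (_, _).
  congr (_ + _)%R; apply/eqP; rewrite -subr_eq0 opprK -[1%R]/(1%:R)%R -natrD.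
  by rewrite (_ : e + 1 = k) ?Zmod_period //; lia.
right; right; split=> //; split=> //.
case: x xy1 xy2 => [[[] p] b] _ _.
  by have [i lt_i di] := mod_cycle_onto p d_inj; exists i => //; right; rewrite /D di.
by have [i lt_i ci] := mod_cycle_onto p c_inj; exists i => //; left; rewrite /C ci.
Qed.

(* Of the k - 1 Hamiltonian cycles of the two levels, one pair absorbs the
   difference k - 1 and the vertical edges, k - 1 - D others absorb one of the
   differences D, ..., k - 2 each, and the rest is doubled; with [pd], the cycle
   of unit steps on level [false] is already covered. *)
Lemma hole_of_spread (pd : bool) D r s : 1 < D < k -> (pd -> D = k - 1) ->
  spread k pd D r s -> s + 7 + (k - 3 - pd).*2 + (k - 1 - D).*2 = 4 * k + r.*2 - 1 ->
  hole (4 * k) r.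
Proof.
move=> D_bounds D_full cov_s s_eq.
have m_gt1 : 1 < m by rewrite /m; lia.
have m_gt0 : 0 < m by lia.
have [f [f_inj f_onto f0]] := hamiltonian_decomposition m_gt0.
rewrite -mE in f f_inj f_onto f0.
have lt_last : m.-1 < m by lia.
pose last := Ordinal lt_last.
(* [t] stands for the cycle [t./2] on level [odd t]. As k - 3 = 2(m - 1), the last cycle of each
   level is left out, being reserved for the linked pair. *)
have idx_lt (t : 'I_(k - 3)) : t./2 < m by have := ltn_ord t; rewrite /m; lia.
pose idx t := Ordinal (idx_lt t).
pose skip (t : nat) := pd && (t == 0).
pose ext (t : nat) := t < k - 1 - D.
pose E (t : 'I_(k - 3)) (x y : inner k) := ~~ skip t /\
  (level_edge (odd t) (f (idx t)) x y \/ ext t /\ mixed_edge (D + t) (D + t).+1 x y).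
pose n (t : nat) := if skip t then 0 else if ext t then 4 else 2.
have cov_E t : sun_cover k (E t) (n t).
  rewrite /E /n; case: ifP => _ /=.
    by exists void, (@of_void _), (@of_void _); split=> [|[]|x y []//]; rewrite card_void.
  case: ifP => _.
    by apply: sun_coverS (cover_level_mixed (odd t) (D + t) (f_inj (idx t))) => x y [_ [|[]]]; auto.
  by apply: sun_coverS (cover_level (odd t) (f_inj (idx t))) => x y [_ [|[]]].
have sum_n : \sum_(t < k - 3) n t = (k - 3 - pd).*2 + (k - 1 - D).*2.
  have [N3 kN] : exists N3, k - 3 = N3.+1 by exists (k - 4); lia.
  rewrite kN big_ord_recl.
  have sum_ext N j : \sum_(t < N) (if t < j then 4 else 2) = N.*2 + (minn N j).*2.
    elim: N => [|N IHN]; first by rewrite big_ord0 min0n.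
    by rewrite big_ord_recr /= IHN; case: ifP; lia.
  have := sum_ext N3 (k - 1 - D).-1.
  rewrite (eq_bigr (fun t : 'I_N3 => n (lift ord0 t))); last first.
    by move=> t _; rewrite /n /skip andbF /ext /= /bump /=; do !case: ifP => ?; lia.
  move=> ->; rewrite /n /skip /ext eqxx andbT /=.
  by case: (pd) D_full => [/(_ isT) ?|_] /=; do ?case: ifP => ?; lia.
pose lift_inl (R : inner k -> inner k -> Prop) (x y : inner k + 'I_r) :=
  exists u v, [/\ x = inl u, y = inl v & R u v].
have cov_lift R n' : sun_cover k R n' -> sun_cover k (lift_inl R) n'.
  move=> cov; apply: (sun_cover_map (@inl_inj _ 'I_r) cov) => x y [u [v [-> -> Ruv]]].
  by exists u, v; split=> //; left.
have cov_linked := cov_lift _ _ (cover_linked_levels (f_inj last) (f_inj last)).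
have cov_rest := cov_lift _ _ (sun_cover_big cov_E).
have cov := sun_coverU (sun_coverU cov_s cov_linked) cov_rest.
have card_inner : #|{: inner k}| = 4 * k.
  rewrite !card_prod card_bool (card_Zmod k_gt1); lia.
rewrite -card_inner -[r in hole _ r]card_ord.
set EE := (X in sun_cover _ X _) in cov.
have EE_lift u v : EE (inl u) (inl v) <-> [\/ mixed_edge 0 D u v \/ pd /\ unit_edge u v,
    [\/ level_edge false (f last) u v, level_edge true (f last) u v,
        mixed_edge (k - 1) k u v | vertical_edge u v] | exists t, E t u v].
  split.
    move=> [[[[u' [v' [Euv E1 E2]]]|[? [? [_]]] //]|[u' [v' [E1 E2 Euv]]]]|[u' [v' [E1 E2 Euv]]]];
    rewrite (inl_inj E1) (inl_inj E2).
    + by constructor 1.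
    + by constructor 2.
    + by constructor 3.
  case=> Euv; [left; left; left|left; right|right]; by exists u, v.
have level_cov l p q b b' i : cycle_edge k (f i) p q -> EE (inl ((l, p), b)) (inl ((l, q), b')).
  move=> pq; apply/EE_lift.
  have le : level_edge l (f i) ((l, p), b) ((l, q), b') by exists p, q, b, b'.
  case: (eqVneq i last) => [Ei|ni].
    by constructor 2; rewrite -Ei; case: (l) le => le; [constructor 2|constructor 1].
  have lt_i : i < m.-1.
    have le_i : i <= m.-1 by have := ltn_ord i; lia.
    by rewrite ltn_neqAle le_i andbT; exact: ni.
  have lt_t : i.*2 + l < k - 3 by move: lt_i mE; clear; lia.
  pose t := Ordinal lt_t.
  case: (boolP (skip t)) => [/andP[Hpd /eqP t0]|Hs].
    constructor 1; right; split=> //; exists p, b, b'.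
    have [l0 i0] : l = false /\ i = 0 :> nat by move: t0; rewrite /=; case: (l); lia.
    have [j lt_j [-> ->]] := pq; rewrite l0; split=> //; congr (_, _, _).
    by rewrite !f0 ?ltn_pmod // natr1 Zp_nat_mod.
  constructor 3; exists t; split=> //; left.
  have -> : odd t = l by rewrite /=; lia.
  by have -> : idx t = i by apply: val_inj; rewrite /=; lia.
have mixed_cov p q b b' : EE (inl ((false, p), b)) (inl ((true, q), b')).
  have [e qE] : exists e : 'Z_k, q = (p + (e : nat)%:R)%R.
    by exists (q - p)%R; rewrite -Zmod_nat // addrC subrK.
  apply/EE_lift.
  have lt_e := Zmod_lt k_gt1 e.
  have mix a a' : a <= e < a' -> mixed_edge a a' ((false, p), b) ((true, q), b').
    by move=> ?; exists p, (e : nat), b, b'; split=> //; rewrite -qE.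
  case: (ltnP e D) => [lt_eD|ge_eD]; first by constructor 1; left; apply: mix.
  case: (ltnP e (k - 1)) => [lt_e1|ge_e1]; last first.
    by constructor 2; constructor 3; apply: mix; lia.
  have lt_t : e - D < k - 3 by lia.
  constructor 3; exists (Ordinal lt_t); split.
    by apply/negP => /andP[/D_full ? _]; lia.
  right; split; first by rewrite /ext /=; lia.
  by apply: mix; rewrite /= subnKC // leqnn ltnSn.
have cov_id := sun_cover_map (f := id) (fun x y Exy => Exy) cov.
apply: (@hole_of_card _ _ (s + 7 + \sum_(t < k - 3) n t)); last first.
  rewrite card_inner card_ord sum_n; lia.
apply: cov_id => x y [ne_xy [u xE]]; exists x, y; split=> //.
case: y ne_xy => [v|w] ne_xy; last by left; left; left; right; exists u, w.
subst x; case: u v ne_xy => [[l p] b] [[l' q] b'] ne_xy.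
have [ll|ll] := eqVneq l l'.
  subst l'; have [pq|/eqP pq] := eqVneq p q.
    subst q; left; apply/EE_lift; constructor 2; constructor 4; split=> //= bb.
    by apply: ne_xy; rewrite bb.
  by have [i [pq'|pq']] := f_onto p q pq; [left|right]; apply: level_cov pq'.
case: l l' ll {ne_xy} => [] [] // _; [right|left]; exact: mixed_cov.
Qed.

End Holes.

(** * Admissible remainders and exceptions *)

Section FourK.

Variable k : nat.
Hypothesis k_gt4 : 4 < k.
Hypothesis k_odd : odd k.

Let k_gt2 : 2 < k. Proof. lia. Qed.

(** Among the products 2, 6, 12, 20 only the last has an odd divisor above 4, namely 5. *)
Lemma small_remainder d : 0 < d -> k %| d * d.+1 -> 4 <= d /\ (d = 4 -> k = 5).
Proof.
move=> d_gt0 dvd_k.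
have divk q : k * q = d * d.+1 -> 4 <= d /\ (d = 4 -> k = 5).
  move=> E; case: (ltnP 4 d) => [?|]; first by split; lia.
  move=> le_d; have le_q : q < 5 by nia.
  by case: d d_gt0 E le_d {dvd_k} => [|[|[|[|[|d]]]]] // _ E _;
    case: q E le_q => [|[|[|[|[|q]]]]] // E _; lia.
by have [q E] := dvdnP dvd_k; apply: (divk q); rewrite mulnC.
Qed.

(** From r < 10k follows G <= 10, so only small d can violate the bounds on G. For d = 4, hence k =
    5, G = 9 is the exception r = 41, and G = 10 means r = 46, not admissible. For d = 0, G = 9 is
    the exception r = 45 if k = 5, and means r = 63, not admissible, if k = 7. *)
Lemma hole_4k r : 2 * k < r < 10 * k -> 4 * k %| r * (r - 1) ->
  ~~ ((k == 5) && ((r == 41) || (r == 45))) -> hole k (4 * k) r.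
Proof.
move=> r_bounds adm exc.
have [G [d [rE lt_d]]] : exists G d, k * G = r + d /\ d < k.
  have := divn_eq r k; have lt_rk : r %% k < k by rewrite ltn_pmod; lia.
  case: (posnP (r %% k)) => r0 E.
    by exists (r %/ k), 0; lia.
  by exists (r %/ k).+1, (k - r %% k); lia.
have G_bounds : 2 < G <= 10 by nia.
have [t tE] := dvdnP adm.
case: (posnP d) => [d0|d_gt0].
  have Gr : r = k * G by lia.
  rewrite {}Gr {rE} in r_bounds tE exc *.
  have G9 : G < 10 by nia.
  have G_small : G <= (k - 1 - (odd k./2).*2).*2.
    case: (leqP 9 k) => k9; first lia.
    have [k5|k7] : k = 5 \/ k = 7 by lia.
      by rewrite k5 in tE exc *; move: exc; rewrite /=; lia.
    rewrite k7 in tE *; rewrite /=; case: (G =P 9) => [G_9|]; last lia.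
    by rewrite G_9 in tE; lia.
  have G_ok : 2 < G <= (k - 1 - (odd k./2).*2).*2 by lia.
  by apply: (hole_of_spread k_gt4 k_odd _ _ (spread_full k_gt4 k_odd G_ok)); lia.
have dvd_d : k %| d * d.+1.
  have E x : (d.+1 + x) * (d.+1 + x - 1) = d * d.+1 + (d.+1 + x + d) * x.
    by rewrite addSn subn1 /=; lia.
  have lt_dr : d < r by lia.
  have {E} := E (r - d.+1); rewrite subnKC // -rE tE => E.
  have dvd_kG : k %| k * G * (r - d.+1) by rewrite -mulnA dvdn_mulr.
  by rewrite -(dvdn_addl _ dvd_kG) -E mulnA dvdn_mull.
have [d4 dk5] := small_remainder d_gt0 dvd_d.
have G_ok : 2 < G <= d.*2.
  case: (ltnP 4 d) => ?; first lia.
  have d_4 : d = 4 by lia.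
  have k5 := dk5 d_4; move: exc; rewrite k5 /=.
  have rG : r = 5 * G - 4 by lia.
  case: (G =P 9) => [G9|]; first by rewrite rG G9.
  case: (G =P 10) => [G9|]; last lia.
  by rewrite rG G9 k5 in tE; lia.
have := spread_staircase k_gt2 k_odd G_ok lt_d; rewrite rE addnK => cov.
by apply: (hole_of_spread k_gt4 k_odd _ _ cov); move: rE d4 lt_d; clear; lia.
Qed.
End FourK.

(** * Nested holes *)

Section Combine.

Variable k : nat.

Lemma hole_add n1 n2 r : hole k n1 (n2 + r) -> hole k n2 r -> hole k (n1 + n2) r.
Proof.
move=> [N1 cov1 E1] [N2 cov2 E2].
have := @hole_of_card k ('I_n1 + 'I_n2)%type 'I_r (N1 + N2).
rewrite card_sum !card_ord; apply; last first.
  rewrite mulnDl E1 E2; case: (n1) (n2) => [|a] [|b]; rewrite ?add0n ?addn0 ?mul0n //.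
  by rewrite -!muln2 !addSn !subn1 !succnK; lia.
pose f1 (x : 'I_n1 + 'I_(n2 + r)) : 'I_n1 + 'I_n2 + 'I_r :=
  match x with
  | inl u => inl (inl u)
  | inr w => match split w with inl v => inl (inr v) | inr v => inr v end
  end.
pose f2 (x : 'I_n2 + 'I_r) : 'I_n1 + 'I_n2 + 'I_r :=
  match x with inl u => inl (inr u) | inr w => inr w end.
pose g1 (x : 'I_n1 + 'I_n2 + 'I_r) : 'I_n1 + 'I_(n2 + r) :=
  match x with
  | inl (inl u) => inl u | inl (inr v) => inr (lshift r v) | inr w => inr (rshift n2 w) end.
have gK : cancel g1 f1.
  by case=> [[u|v]|w] //=; rewrite ?(unsplitK (inl v)) ?(unsplitK (inr w)).
have fK : cancel f1 g1.
  by case=> [u|w] //=; case: splitP => j E; congr inr; apply: val_inj.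
have f2_inj : injective f2.
  by move=> [u|w] [u'|w'] // E; [have -> := inr_inj (inl_inj E)|have -> := inr_inj E].
have := sun_coverU (sun_cover_map (E' := fun x y => hole_edge (g1 x) (g1 y)) (can_inj fK) cov1 _)
  (sun_cover_map (E' := fun x y =>
     exists u v, [/\ x = f2 u, y = f2 v & hole_edge u v]) f2_inj cov2 _).
move=> cov; apply: (sun_cover_map (f := id) _ (cov _ _)) => // x y.
- by move=> Exy; exists (g1 x), (g1 y); rewrite !gK; split=> //; left.
- by move=> [u [v [-> -> Euv]]]; exists u, v; split=> //; left.
move=> [ne_xy [u xE]]; exists x, y; split=> //.
case: u xE => [u|u] xE; subst x.
  by left; left; split; [move/(can_inj gK) | exists u].
case: y ne_xy => [[v|v]|v] ne_xy.
- by right; left; split; [move/(can_inj gK)/esym | exists v].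
- left; right; exists (inl u), (inl v); split=> //; split; last by exists u.
  by move=> E0; have E := inl_inj E0; apply: ne_xy; rewrite E.
by left; right; exists (inl u), (inr v); split=> //; split; [|exists u].
Qed.

End Combine.

(** * Inflation by a commutative quasigroup with holes *)

Section Inflation.

Variables (k : nat) (P S : finType) (op : P * S -> P * S -> P * S).
Hypotheses (k_gt2 : 2 < k) (k_odd : odd k).
Hypothesis opC : commutative op.
Hypothesis op_group : forall u v, u.1 != v.1 -> (op u v).1 != u.1.
Hypothesis op_solve : forall u w : P * S, u.1 != w.1 -> exists2 v, u.1 != v.1 & op u v = w.

Local Notation level := (P * S)%type.
Local Notation m := k./2.

Let k_gt1 : 1 < k. Proof. lia. Qed.
Let k_gt0 : 0 < k. Proof. lia. Qed.

(** The first k - 1 vertices zigzag between levels u and v with differences m - 1 down to -(m - 1).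
    The last vertex closes the cycle through a level in a third hole, at offset m from both of its
    neighbours. *)
Definition zigzag_cycle (u v : level) (t : 'Z_k) (i : nat) : level * 'Z_k :=
  if i == k.-1 then (op u v, (t + m%:R)%R)
  else if odd i then (v, (t + (m.-1 - i./2)%:R)%R) else (u, (t + (i./2)%:R)%R).

Lemma zigzag_cycle_inj u v t : u.1 != v.1 -> {in gtn k &, injective (zigzag_cycle u v t)}.
Proof.
move=> uv.
have vu : v.1 != u.1 by rewrite eq_sym.
have neq (a b : level) (p q : 'Z_k) : a.1 != b.1 -> (a, p) <> (b, q).
  by move=> ab E; move: ab; have /= -> := congr1 fst E; rewrite eqxx.
have posE (a b : level) p q : (a, t + p%:R)%R = (b, t + q%:R)%R -> p < k -> q < k -> p = q.
  move=> E lt_p lt_q; apply: (Zmod_nat_inj k_gt1 lt_p lt_q).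
  by have /addrI := congr1 snd E.
have wu := op_group uv; have wv : (op u v).1 != v.1 by rewrite opC op_group.
move=> i j; rewrite !inE /zigzag_cycle => lt_i lt_j.
do !case: ifP => ?; try lia;
  try (by move=> /neq; rewrite ?uv ?vu ?wu ?wv ?(eq_sym u.1) ?(eq_sym v.1) ?wu ?wv => /(_ isT));
by move=> /posE H; have := H ltac:(lia) ltac:(lia); lia.
Qed.

Definition zigzag_adj (u v : level) (x y : level * 'Z_k) : Prop :=
  exists t, cycle_edge k (zigzag_cycle u v t) x y \/ cycle_edge k (zigzag_cycle u v t) y x.

Lemma zigzag_adj_next u v t i : i.+1 < k ->
  zigzag_adj u v (zigzag_cycle u v t i) (zigzag_cycle u v t i.+1).
Proof. by move=> lt_i; exists t; left; exists i; [exact: ltnW | rewrite modn_small]. Qed.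

Lemma zigzag_adjC u v x y : zigzag_adj u v x y -> zigzag_adj u v y x.
Proof. by case=> t [|] E; exists t; [right|left]. Qed.

Lemma zigzag_adj_short u v p q (e : 'Z_k) : q = (p + e)%R ->
  e != m :> nat -> e != m.+1 :> nat -> zigzag_adj u v (u, p) (v, q).
Proof.
move=> qE e_m e_m1; have lt_e := Zmod_lt k_gt1 e.
(* The j-th step has difference m - 1 - j, read modulo k = 2m + 1. *)
pose j := if e < m then m.-1 - e else 3 * m - e.
have lt_j : j.+2 < k by rewrite /j; case: ifP; lia.
pose t := (p - (uphalf j)%:R)%R.
have pE : p = (t + (uphalf j)%:R)%R by rewrite subrK.
have {qE} qE : q = (t + (m.-1 - j./2)%:R)%R.
  rewrite qE pE -addrA; congr (_ + _)%R; rewrite {1}(Zmod_nat e) -natrD.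
  rewrite /j; case: ifP => ?; first by congr (_ %:R)%R; lia.
  rewrite -[RHS]addr0 -(Zmod_period k_gt1) -natrD; congr (_ %:R)%R; lia.
have := @zigzag_adj_next u v t j (ltnW lt_j); rewrite /zigzag_cycle.
have [-> ->] : (j == k.-1) = false /\ (j.+1 == k.-1) = false by lia.
case: (boolP (odd j)) => oj /=; first by rewrite oj -pE -qE => /zigzag_adjC.
have jj : uphalf j = j./2 by lia.
by rewrite (negbTE oj) jj -qE; rewrite jj in pE; rewrite -pE.
Qed.

Lemma zigzag_adj_long u v p : zigzag_adj u v (u, p) (op u v, p + m%:R)%R /\
  zigzag_adj v u (u, p) (op u v, p + m%:R)%R.
Proof.
split.
  exists p; right; exists k.-1; rewrite ?prednK // modnn /zigzag_cycle eqxx.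
  by case: ifP => [|_]; [lia|rewrite addr0].
have lt_k : k.-2.+1 < k by lia.
have := @zigzag_adj_next v u p k.-2 lt_k; rewrite /zigzag_cycle.
have -> : (k.-2.+1 == k.-1) = true by lia.
case: ifP => [|_]; first by lia.
have -> : odd k.-2 = true by lia.
have -> : m.-1 - k.-2./2 = 0 by lia.
by rewrite addr0 opC.
Qed.

(* Over a pair {u, v} the zigzag realises all differences between levels u and
   v except m and -m; these arise as the closing edges over the pairs whose
   product is u or v. *)
Lemma zigzag_adj_exists u v p q : u.1 != v.1 -> exists a b,
  [/\ a.1 != b.1, zigzag_adj a b (u, p) (v, q) & zigzag_adj b a (u, p) (v, q)].
Proof.
move=> uv; pose e := (q - p)%R.
have qE : q = (p + e)%R by rewrite /e addrC subrK.
have pE : p = (q - e)%R by rewrite qE addrK.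
case: (eqVneq (e : nat) m) => [em|e_m].
  have [x ux <-] := op_solve uv; exists u, x.
  have [adj adj'] := zigzag_adj_long u x p.
  by have -> : q = (p + m%:R)%R by rewrite qE (Zmod_nat e) em.
case: (eqVneq (e : nat) m.+1) => [em|e_m1].
  rewrite eq_sym in uv; have [x vx <-] := op_solve uv; exists v, x.
  have [adj adj'] := zigzag_adj_long v x q.
  have -> : p = (q + m%:R)%R.
    rewrite pE {1}(Zmod_nat e) em; congr (_ + _)%R; apply/eqP.
    rewrite eq_sym -subr_eq0 opprK -natrD (_ : m + m.+1 = k) ?Zmod_period //; lia.
  by split=> //; apply: zigzag_adjC.
have oppE (x y : nat) : x + y = k -> y < k -> (- e)%R != x :> nat \/ (e : nat) = y.
  move=> xy lt_y; case: (eqVneq ((- e)%R : nat) x) => [ex|]; [right|by left].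
  have -> : e = y%:R%R.
    apply: oppr_inj; apply/eqP; rewrite -subr_eq0 opprK.
    by rewrite {1}(Zmod_nat (- e)%R) ex -natrD xy Zmod_period.
  by rewrite val_Zp_nat // modn_small.
exists u, v; split=> //; first exact: zigzag_adj_short qE _ _.
apply: zigzag_adjC; apply: (zigzag_adj_short v u pE).
  by case: (oppE m m.+1) => //; try lia; move=> E; rewrite E eqxx in e_m1.
by case: (oppE m.+1 m) => //; try lia; move=> E; rewrite E eqxx in e_m.
Qed.

(** Picks one orientation of each pair of levels; either will do, as [zigzag_adj_exists] provides an
    edge in both zigzags over the pair. *)
Definition active (ab : level * level) :=
  (enum_rank ab.1 < enum_rank ab.2) && (ab.1.1 != ab.2.1).

Lemma cover_inflated :
  sun_cover k (fun x y : (level * 'Z_k) * bool => x.1.1.1 != y.1.1.1) (#|active| * k.*2).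
Proof.
pose E (ab : level * level) (x y : (level * 'Z_k) * bool) :=
  active ab /\ exists t, cycle_edge k (zigzag_cycle ab.1 ab.2 t) x.1 y.1.
have cov_E ab : sun_cover k (E ab) (active ab * k.*2).
  rewrite /E; case: (boolP (active ab)) => [/andP[_ ne]|_].
    have := sun_cover_big (fun t => cover_double_cycle k_gt2 (zigzag_cycle_inj (t := t) ne)).
    rewrite sum_nat_const card_Zmod // muln2 mul1n.
    by apply: sun_coverS => x y [].
  by exists void, (@of_void _), (@of_void _); split=> [|[]|x y []//]; rewrite card_void.
have -> : #|active| * k.*2 = \sum_ab active ab * k.*2.
  by rewrite -big_distrl /= -sum1_card big_mkcond.
apply: (sun_cover_map (f := id) _ (sun_cover_big cov_E)) => // [[[u p] b] [[v q] b']] /= uv.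
exists (u, p, b), (v, q, b'); split=> //.
have [a [c [ac adj adj']]] := zigzag_adj_exists p q uv.
have act : active (a, c) \/ active (c, a).
  rewrite /active /= ac eq_sym ac !andbT; case: ltngtP => //; auto.
  by move=> E'; move: ac; rewrite (enum_rank_inj (val_inj E')) eqxx.
case: act => act; [case: adj | case: adj'] => t [cE|cE]; [left|right|left|right].
- by exists (a, c); split=> //; exists t.
- by exists (a, c); split=> //; exists t.
- by exists (c, a); split=> //; exists t.
- by exists (c, a); split=> //; exists t.
Qed.

Lemma card_active : #|active| * 2 = #|P| * #|S| * ((#|P| - 1) * #|S|).
Proof.
pose apart (ab : level * level) : nat := ab.1.1 != ab.2.1.
have <- : \sum_ab apart ab = #|P| * #|S| * ((#|P| - 1) * #|S|).
  rewrite -(pair_bigA _ (fun a b => apart (a, b))) /=.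
  rewrite (eq_bigr (fun=> (#|P| - 1) * #|S|)).
    by rewrite sum_nat_const card_prod.
  move=> [g x] _; rewrite -(pair_bigA _ (fun h y => apart ((g, x), (h, y)))) /=.
  rewrite (eq_bigr (fun h => (g != h) * #|S|)); last first.
    by move=> h _; rewrite /apart /= sum_nat_const mulnC.
  rewrite -big_distrl /=; congr (_ * _); rewrite subn1 -(cardC1 g) -sum1_card [RHS]big_mkcond /=.
  by apply: eq_bigr => h _; rewrite !inE eq_sym; case: eqP.
have cardE : #|active| = \sum_ab (active ab : nat).
  rewrite -sum1_card [LHS]big_mkcond; apply: eq_bigr => ab _.
  by rewrite -[ab \in _]/(active ab); case: (active ab).
pose swap (ab : level * level) := (ab.2, ab.1).
have swapK : involutive swap by case.
rewrite muln2 -addnn {2}cardE (reindex_inj (inv_inj swapK)) cardE -big_split /=.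
apply: eq_bigr => [[a b]] _; rewrite /active /apart /swap /= [b.1 == _]eq_sym.
case: (eqVneq a.1 b.1) => [_|ne]; first by rewrite !andbF.
rewrite !andbT; case: ltngtP => // E.
by move: ne; rewrite (enum_rank_inj (val_inj E)) eqxx.
Qed.

(** The 2s levels with a common first component carry a copy of the given decomposition; edges
    between different first components are left to [cover_inflated]. *)
Lemma hole_inflate s r : #|S| = 2 * s -> hole k (4 * k * s) r -> hole k (4 * k * s * #|P|) r.
Proof.
move=> S2s [N0 cov0 N0E].
pose V := ((level * 'Z_k) * bool)%type.
pose W := ((S * 'Z_k) * bool)%type.
have card_W : #|{: W}| = 4 * k * s by rewrite !card_prod card_bool card_Zmod // S2s; lia.
pose f g (x : 'I_(4 * k * s) + 'I_r) : V + 'I_r := match x with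
  | inl i => let w : W := enum_val (cast_ord (esym card_W) i) in inl (((g, w.1.1), w.1.2), w.2)
  | inr j => inr j end.
have f_inj g : injective (f g).
  move=> [i|i] [j|j] // E0; last by have -> := inr_inj E0.
  have E := inl_inj E0; congr inl.
  apply: (@cast_ord_inj _ _ (esym card_W)); apply: enum_val_inj.
  move: (congr1 (fun u => u.1.1.2) E) (congr1 (fun u => u.1.2) E) (congr1 snd E) => /=.
  by case: (enum_val _) => [[? ?] ?]; case: (enum_val _) => [[? ?] ?] /= -> -> ->.
have f_onto g y p b : exists i, f g (inl i) = inl (((g, y), p), b).
  by exists (cast_ord card_W (enum_rank ((y, p), b))); rewrite /f cast_ordK enum_rankK.
pose E g (x y : V + 'I_r) := exists x' y', [/\ x = f g x', y = f g y' & hole_edge x' y'].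
have covE g : sun_cover k (E g) N0.
  apply: (sun_cover_map (f_inj g) cov0) => x y [x' [y' [-> -> Exy]]].
  by exists x', y'; split=> //; left.
pose E' (x y : V + 'I_r) := exists u v : V, [/\ x = inl u, y = inl v & u.1.1.1 != v.1.1.1].
have covE' : sun_cover k E' (#|active| * k.*2).
  apply: (sun_cover_map (@inl_inj _ 'I_r) cover_inflated) => x y [u [v [-> -> uv]]].
  by exists u, v; split=> //; left.
have := @hole_of_card k V 'I_r (\sum_(g : P) N0 + #|active| * k.*2).
rewrite sum_nat_const.
have -> : #|{: V}| = 4 * k * s * #|P|.
  by rewrite !card_prod card_bool card_Zmod // S2s; lia.
rewrite card_ord; apply; last first.
  have := card_active; rewrite S2s; move: (#|active|) (#|P|) => a p aE.
  have nE : a * k.*2 * (4 * k) = 4 * k * s * (4 * k * s * (p * (p - 1))).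
    transitivity (a * 2 * (4 * k * k)); [lia | rewrite aE; lia].
  rewrite mulnDl nE -mulnA N0E; move: (4 * k * s) => x {nE aE N0E}.
  case: p => [|p]; first by rewrite !(muln0, mul0n).
  case: x => [|x]; first by rewrite !(muln0, mul0n).
  rewrite !subn1 /=; nia.
rewrite -sum_nat_const.
apply: sun_coverS (sun_coverU (sun_cover_big covE) covE') => x y [ne_xy [u xE]].
case: u xE => [[[g a] p] b] xE; subst x; have [i iE] := f_onto g a p b.
case: y ne_xy => [[[[h c] q] b']|j] ne_xy.
  have [gh|gh] := eqVneq g h; last by right; exists (((g, a), p), b), (((h, c), q), b').
  subst h; left; exists g; have [j jE] := f_onto g c q b'.
  exists (inl i), (inl j); split=> //; split; last by exists i.
  by move=> ij; apply: ne_xy; rewrite -iE -jE ij.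
by left; exists g, (inl i), (inr j); split=> //; split=> //; exists i.
Qed.

End Inflation.

(** * Two families of quasigroups with holes *)

Section Products.

Local Open Scope ring_scope.

(** For h one half, the first component is the mean, an idempotent commutative quasigroup; the
    factor [A] blows its idempotents up into holes. *)
Definition mean_op (R : pzRingType) (A : zmodType) (h : R) (u v : R * A) : R * A :=
  (h * (u.1 + v.1), u.2 + v.2).

Lemma mean_opC (R : pzRingType) (A : zmodType) (h : R) : commutative (@mean_op R A h).
Proof. by move=> u v; rewrite /mean_op [u.1 + _]addrC [u.2 + _]addrC. Qed.

Lemma mean_op_group (R : comPzRingType) (A : zmodType) (h : R) (u v : R * A) :
  h + h = 1 -> u.1 != v.1 -> (mean_op h u v).1 != u.1.
Proof.
move=> hh; apply: contraNneq => /= E; apply/eqP.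
have : h * (u.1 + v.1) + h * (u.1 + v.1) = u.1 + u.1 by rewrite E.
by rewrite -mulrDl hh mul1r => /addrI.
Qed.

Lemma mean_op_solve (R : comPzRingType) (A : zmodType) (h : R) (u w : R * A) :
  h + h = 1 -> u.1 != w.1 -> exists2 v, u.1 != v.1 & mean_op h u v = w.
Proof.
move=> hh uw; exists (w.1 + w.1 - u.1, w.2 - u.2) => /=.
  apply: contraNneq uw => /(congr1 (fun x => h * (x + u.1))).
  by rewrite subrK !mulrDr -!mulrDl hh !mul1r => ->.
rewrite /mean_op /= addrC subrK [u.2 + _]addrC subrK mulrDr -mulrDl hh mul1r.
by case: w {uw}.
Qed.

End Products.

(* The nonzero vectors of the plane over Z/3, split into a line and a sign;
   [minus_sum] is (u, v) -> - (u + v). *)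
Definition plane_vector (u : (bool * bool) * bool) : nat * nat :=
  match u with
  | (false, false, s) => (s.+1, 0)
  | (false, true, s) => (0, s.+1)
  | (true, false, s) => (s.+1, s.+1)
  | (true, true, s) => (s.+1, 2 - s)
  end.

Definition line_sign (x : nat * nat) : (bool * bool) * bool :=
  if x.1 == 0 then (false, true, x.2 == 2)
  else (if x.2 == 0 then (false, false) else (true, x.1 != x.2), x.1 == 2).

Definition minus_sum (u v : (bool * bool) * bool) : (bool * bool) * bool :=
  let x := plane_vector u in let y := plane_vector v in
  line_sign ((6 - (x.1 + y.1)) %% 3, (6 - (x.2 + y.2)) %% 3).

Definition plane_op (A : zmodType) (u v : (bool * bool) * (bool * A)) :
    (bool * bool) * (bool * A) :=
  let w := minus_sum (u.1, u.2.1) (v.1, v.2.1) in (w.1, (w.2, (u.2.2 + v.2.2)%R)).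

(** Three vectors with sum zero determine one another, and if two of them lie on different lines,
    the third lies on neither. *)
Lemma minus_sumP (u v : (bool * bool) * bool) :
  [&& minus_sum u v == minus_sum v u
    & (u.1 != v.1) ==> ((minus_sum u v).1 != u.1) && (minus_sum u (minus_sum u v) == v)].
Proof. by case: u v => [[[] []] []] [[[] []] []]. Qed.

(** * Multiples of a hole *)

Section Multiples.

Variable k : nat.
Hypotheses (k_gt2 : 2 < k) (k_odd : odd k).

Lemma hole_odd_multiple p s r : 1 < p -> odd p -> 0 < s ->
  hole k (4 * k * s) r -> hole k (4 * k * s * p) r.
Proof.
move=> p_gt1 p_odd; case: s => // s _ hole_s.
(* (p + 1)/2 is the inverse of 2 modulo the odd number p. *)
have hh : ((p.+1./2)%:R + (p.+1./2)%:R = 1 :> 'Z_p)%R.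
  rewrite -natrD (_ : _ + _ = p.+1); last lia.
  by rewrite -natr1 Zmod_period // add0r.
have opC := @mean_opC 'Z_p 'I_(s.*2.+1).+1 (p.+1./2)%:R%R.
have := @hole_inflate k _ _ _ k_gt2 k_odd opC.
rewrite card_ord card_Zmod // => infl; apply: infl hole_s => //.
- by move=> u v; apply: mean_op_group.
- by move=> u v; apply: mean_op_solve.
lia.
Qed.

Lemma hole_fourfold s r : 0 < s -> hole k (4 * k * s) r -> hole k (4 * k * s * 4) r.
Proof.
case: s => // s _ hole_s.
have opC : commutative (@plane_op 'I_s.+1).
  move=> u v; rewrite /plane_op [(u.2.2 + _)%R]addrC.
  by have /andP[/eqP-> _] := minus_sumP (u.1, u.2.1) (v.1, v.2.1).
have := @hole_inflate k _ _ _ k_gt2 k_odd opC.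
rewrite !card_prod !card_bool card_ord => infl; apply: infl hole_s => //.
  move=> u v uv; have /andP[_ /implyP/(_ uv)/andP[]] := minus_sumP (u.1, u.2.1) (v.1, v.2.1).
  by [].
move=> u w uw; have /andP[_ /implyP/(_ uw)/andP[ne /eqP E]] := minus_sumP (u.1, u.2.1) (w.1, w.2.1).
pose v := minus_sum (u.1, u.2.1) (w.1, w.2.1).
exists (v.1, (v.2, (w.2.2 - u.2.2)%R)).
  by rewrite /= eq_sym.
rewrite /plane_op /= -surjective_pairing E /= addrC subrK.
by case: (w) => [? []].
Qed.

Lemma hole_multiple q r : 0 < q -> hole k (4 * k) r -> hole k (4 * k * 2) r ->
  hole k (4 * k * q) r.
Proof.
move=> q_gt0 hole1 hole2; elim/ltn_ind: q q_gt0 => q IHq q_gt0.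
case: (boolP (odd q)) => oq.
  case: (leqP q 1) => q1; first by rewrite (_ : q = 1) ?muln1 //; lia.
  by rewrite -[4 * k]muln1; apply: hole_odd_multiple => //; rewrite muln1.
case: (boolP (odd q./2)) => oq2.
  case: (leqP q 2) => q2; first by rewrite (_ : q = 2) //; lia.
  have -> : 4 * k * q = 4 * k * 2 * q./2 by rewrite -!(mulnA (4 * k)); congr (_ * _); lia.
  by apply: hole_odd_multiple => //; lia.
have -> : 4 * k * q = 4 * k * (q %/ 4) * 4 by rewrite -!(mulnA (4 * k)); congr (_ * _); lia.
have q4 : 0 < q %/ 4 < q by lia.
by apply: hole_fourfold; [lia | apply: IHq; lia].
Qed.

End Multiples.

(** * Decompositions given by tables *)

Section Tables.

Variables (k L r : nat).
Hypotheses (k_gt2 : 2 < k) (L_gt0 : 0 < L).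

Local Notation n := (L * k).

Local Notation table := (seq (seq nat * seq nat)).

(* Vertex l * k + p, p < k, is position p of level l, and the vertices from
   L * k on are fixed by the rotation of all levels. *)
Definition rotate (t x : nat) : nat := if x < n then x %/ k * k + (x + t) %% k else x.

(** The suns in [short] are taken as they stand; in the tables below they are the ones that rotation
    maps to themselves. *)
Definition develop (base short : table) : table :=
  [seq (map (rotate t) s.1, map (rotate t) s.2) | s <- base, t <- iota 0 k] ++ short.

Definition sun_ok (s : seq nat * seq nat) : bool :=
  [&& size s.1 == k, size s.2 == k, uniq (s.1 ++ s.2) & all (gtn (n + r)) (s.1 ++ s.2)].

Definition sun_edges (s : seq nat * seq nat) : seq (nat * nat) :=
  zip s.1 (rot 1 s.1) ++ zip s.1 s.2.

Definition table_edges (suns : table) : seq (nat * nat) := flatten (map sun_edges suns).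

Definition swap (e : nat * nat) : nat * nat := (e.2, e.1).

(* By rotation invariance only pairs with one vertex at position 0 of its level
   need checking; developing all suns for the check would be too slow. *)
Definition normal_ends (base : table) (l : nat) : seq nat :=
  [seq rotate (k - e.1 %% k) e.2 |
    e <- table_edges base ++ map swap (table_edges base) & (e.1 < n) && (e.1 %/ k == l)].

Definition orbit_in (edges : seq (nat * nat)) (x y : nat) : bool :=
  all (fun t => let e := (rotate t x, rotate t y) in (e \in edges) || (swap e \in edges))
      (iota 0 k).

Definition table_ok (base short : table) : bool :=
  [&& all sun_ok (develop base short),
      (k * size base + size short) * (4 * k) == n * (n + r.*2 - 1)
    & let edges := table_edges short in
      all (fun l => let ends := normal_ends base l in
        all (fun y => [|| y == l * k, y \in ends | orbit_in edges (l * k) y])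
            (iota 0 (n + r))) (iota 0 L)].

Lemma rotateD a b x : rotate a (rotate b x) = rotate (a + b) x.
Proof.
have k_gt0 : 0 < k by lia.
rewrite /rotate; case: (ltnP x n) => [lt_x|ge_x]; last by rewrite ltnNge ge_x.
have lt_m := ltn_pmod (x + b) k_gt0.
have -> : x %/ k * k + (x + b) %% k < n.
  have : x %/ k < L by rewrite ltn_divLR.
  by nia.
rewrite divnMDl // (divn_small lt_m) addn0; congr (_ + _).
by rewrite -addnA modnMDl modnDml -addnA [b + a]addnC.
Qed.

Lemma rotate_period t x : k %| t -> rotate t x = x.
Proof.
move=> /dvdnP[q ->]; rewrite /rotate; case: ifP => // _.
by rewrite -modnDmr modnMl addn0 -divn_eq.
Qed.

Lemma rotate_to x t : x < n -> k %| x %% k + t -> rotate t x = x %/ k * k.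
Proof.
move=> lt_x dvd_k; rewrite /rotate lt_x -modnDml.
by move/eqP: dvd_k => ->; rewrite addn0.
Qed.

Lemma sun_edges_map f s :
  sun_edges (map f s.1, map f s.2) = [seq (f e.1, f e.2) | e <- sun_edges s].
Proof.
have zipE : forall a b, zip (map f a) (map f b) = [seq (f e.1, f e.2) | e <- zip a b].
  by elim=> [|x a IHa] [|y b] //=; rewrite IHa.
by rewrite /sun_edges /= map_cat -map_rot !zipE.
Qed.

Lemma rotate_table_edge base short t e : t < k -> e \in table_edges base ->
  (rotate t e.1, rotate t e.2) \in table_edges (develop base short).
Proof.
move=> lt_t /flattenP[_ /mapP[s s_base ->] e_s].
apply/flattenP; exists (sun_edges (map (rotate t) s.1, map (rotate t) s.2)).
  apply: map_f; rewrite mem_cat; apply/orP; left.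
  by apply/allpairsP; exists (s, t); rewrite mem_iota.
by rewrite sun_edges_map; apply: map_f.
Qed.

Lemma short_table_edge base short e :
  e \in table_edges short -> e \in table_edges (develop base short).
Proof. by rewrite /table_edges map_cat flatten_cat mem_cat orbC => ->. Qed.

Lemma table_okP base short x y : table_ok base short -> x < n -> y < n + r -> x != y ->
  ((x, y) \in table_edges (develop base short)) || ((y, x) \in table_edges (develop base short)).
Proof.
have k_gt0 : 0 < k by lia.
case/and3P=> _ _ /allP cov lt_x lt_y ne_xy.
pose l := x %/ k; pose p := x %% k.
have lt_p : p < k by rewrite ltn_pmod.
have lt_l : l < L by rewrite ltn_divLR.
have xE : x = rotate p (l * k).
  have lt_lk : l * k < n by rewrite ltn_pmul2r.
  by rewrite /rotate lt_lk mulnK // modnMDl modn_small // -divn_eq.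
pose y' := rotate (k - p) y.
have yE : y = rotate p y' by rewrite rotateD subnKC 1?ltnW // rotate_period.
have lt_y' : y' < n + r.
  rewrite /y' /rotate; case: (ltnP y n) => // lt_yn.
  have : y %/ k < L by rewrite ltn_divLR.
  have := ltn_pmod (y + (k - p)) k_gt0; nia.
have /allP/(_ y') := cov l ltac:(by rewrite mem_iota).
rewrite mem_iota => /(_ lt_y') /or3P[/eqP y'E|/mapP[e]|/allP/(_ p)].
- by move: ne_xy; rewrite xE yE y'E eqxx.
- rewrite mem_filter => /andP[/andP[lt_e /eqP el] e_in] y'E.
  have x_rot : rotate (k - e.1 %% k + p) e.1 = x.
    have e1_rot : rotate (k - e.1 %% k) e.1 = l * k.
      by rewrite rotate_to ?el // subnKC // ltnW // ltn_pmod.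
    by rewrite addnC -rotateD e1_rot.
  have y_rot : rotate (k - e.1 %% k + p) e.2 = y by rewrite addnC -rotateD -y'E.
  set t := _ + p in x_rot y_rot; have lt_t : t %% k < k by rewrite ltn_pmod.
  have rot_mod z : rotate (t %% k) z = rotate t z by rewrite /rotate modnDmr.
  move: e_in; rewrite mem_cat => /orP[|/mapP[f] f_in].
    by move/(rotate_table_edge short lt_t); rewrite !rot_mod x_rot y_rot => ->.
  have := rotate_table_edge short lt_t f_in; rewrite !rot_mod => f_rot ef.
  by move: x_rot y_rot f_rot; rewrite ef /= => -> -> ->; rewrite orbT.
rewrite mem_iota => /(_ lt_p); rewrite -xE -yE.
by case/orP=> /(short_table_edge base) ->; rewrite ?orbT.
Qed.

Lemma hole_of_table base short : table_ok base short -> hole k n r.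
Proof.
have k_gt0 : 0 < k by lia.
have N_gt0 : 0 < n + r by nia.
move=> tab_ok; have cov := table_okP tab_ok; case/and3P: tab_ok.
have <- : size (develop base short) = k * size base + size short.
  by rewrite size_cat size_allpairs size_iota mulnC.
rewrite /table_edges in cov *; move: (develop base short) cov => suns cov ok /eqP sizeE _.
pose vx (x : nat) : 'I_(n + r) := insubd (Ordinal N_gt0) x.
have vxE x : x < n + r -> vx x = x :> nat by move=> lt_x; rewrite val_insubd lt_x.
pose s (t : 'I_(size suns)) := nth ([::], [::]) suns t.
have s_ok t : sun_ok (s t) by apply: (allP ok); apply: mem_nth.
have lab t : sun_labelling k (fun i => vx (nth 0 (s t).1 i)) (fun i => vx (nth 0 (s t).2 i)).
  have /and4P[/eqP size1 /eqP size2] := s_ok t.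
  rewrite cat_uniq all_cat => /and3P[u1 disj u2] /andP[/allP v1 /allP v2].
  have in1 i : i < k -> nth 0 (s t).1 i \in (s t).1 by move=> ?; rewrite mem_nth ?size1.
  have in2 i : i < k -> nth 0 (s t).2 i \in (s t).2 by move=> ?; rewrite mem_nth ?size2.
  split=> i j; rewrite ?inE => lt_i lt_j /(congr1 val) /=.
  - by rewrite !vxE; [move/eqP; rewrite nth_uniq ?size1 // => /eqP| exact/v1/in1 | exact/v1/in1].
  - by rewrite !vxE; [move/eqP; rewrite nth_uniq ?size2 // => /eqP| exact/v2/in2 | exact/v2/in2].
  rewrite !vxE; [|exact/v2/in2 | exact/v1/in1].
  move=> E; case/negP: disj; apply/hasP; exists (nth 0 (s t).2 j); first exact: in2.
  by rewrite /= -E; apply: in1.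
have edge x y : (x, y) \in flatten (map sun_edges suns) ->
    exists t, sun_edge k (fun i => vx (nth 0 (s t).1 i)) (fun i => vx (nth 0 (s t).2 i))
      (vx x) (vx y).
  case/flattenP=> _ /mapP[s' /(nthP ([::], [::]))[t lt_t <-] ->] xy.
  exists (Ordinal lt_t); have /and4P[/eqP size1 /eqP size2 _ _] := s_ok (Ordinal lt_t).
  move: xy; rewrite -/(s (Ordinal lt_t)) /sun_edges mem_cat => /orP[] /(nthP (0, 0))[i].
    rewrite size_zip size_rot minnn size1 => lt_i.
    rewrite nth_zip ?size_rot // => -[<- <-]; exists i => //; split=> //; left.
    congr vx; rewrite nth_cat size_drop size1 nth_drop add1n.
    case: ltnP => ?; first by rewrite modn_small //; lia.
    have -> : i.+1 = k by lia.
    by rewrite modnn (_ : i - (k - 1) = 0) ?nth_take //; lia.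
  rewrite size_zip size1 size2 minnn => lt_i.
  by rewrite nth_zip ?size1 ?size2 // => -[<- <-]; exists i => //; split=> //; right.
exists (size suns) => //.
have split_inj : injective (@split n r) by apply: can_inj (@splitK n r).
have cov_n : sun_cover k (fun x y : 'I_(n + r) => x <> y /\ x < n) (size suns).
  exists 'I_(size suns), (fun t i => vx (nth 0 (s t).1 i)), (fun t i => vx (nth 0 (s t).2 i)).
  split=> //; first by rewrite card_ord.
  move=> x y [ne_xy lt_x].
  have vxK (z : 'I_(n + r)) : vx z = z by apply: val_inj; rewrite /= vxE.
  have ne_val : val x != val y by apply/eqP => /val_inj.
  case/orP: (cov _ _ lt_x (ltn_ord y) ne_val) => /edge[t]; rewrite !vxK => Et; exists t.
    by left.
  by right.
apply: (sun_cover_map split_inj cov_n) => x y [ne_xy [u xE]].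
exists (unsplit x), (unsplit y); rewrite !unsplitK; split=> //; left; split.
  by move/(can_inj (@unsplitK _ _)).
by rewrite xE /=.
Qed.

End Tables.

(** For k = 3 the admissible r strictly between 6 and 18 are 9, 12, 13 and 16; each has a table for
    4k and one for 8k further vertices. *)
Lemma hole_3_12_12 : hole 3 (4 * 3) 12.
Proof.
apply: (@hole_of_table 3 4 12 _ _ [::
   ([:: 9; 11; 3], [:: 16; 13; 12]); ([:: 3; 7; 20], [:: 21; 14; 10]);
   ([:: 14; 1; 11], [:: 3; 19; 23]); ([:: 6; 11; 19], [:: 15; 8; 5]);
   ([:: 6; 0; 13], [:: 23; 7; 5]); ([:: 0; 12; 9], [:: 22; 8; 17]);
   ([:: 21; 10; 6], [:: 0; 18; 8]); ([:: 6; 1; 18], [:: 17; 23; 5]);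
   ([:: 3; 10; 22], [:: 17; 2; 6]); ([:: 0; 15; 4], [:: 20; 10; 6]);
   ([:: 0; 16; 5], [:: 17; 8; 23])] [::
   ([:: 0; 1; 2], [:: 3; 4; 5]); ([:: 3; 4; 5], [:: 6; 7; 8])]); [by []|by []|by vm_compute].
Qed.

Lemma hole_3_12_13 : hole 3 (4 * 3) 13.
Proof.
apply: (@hole_of_table 3 4 13 _ _ [::
   ([:: 12; 6; 3], [:: 9; 19; 22]); ([:: 0; 13; 7], [:: 21; 4; 18]);
   ([:: 15; 11; 2], [:: 3; 13; 18]); ([:: 9; 21; 6], [:: 19; 3; 15]);
   ([:: 0; 6; 23], [:: 8; 22; 4]); ([:: 9; 10; 8], [:: 23; 22; 7]);
   ([:: 6; 16; 4], [:: 20; 2; 11]); ([:: 9; 14; 1], [:: 18; 6; 19]);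
   ([:: 9; 17; 2], [:: 16; 3; 12]); ([:: 6; 24; 5], [:: 17; 2; 0]);
   ([:: 3; 20; 2], [:: 14; 9; 22]); ([:: 3; 11; 5], [:: 18; 24; 19])] [::
   ([:: 0; 1; 2], [:: 3; 4; 5])]); [by []|by []|by vm_compute].
Qed.

Lemma hole_3_12_16 : hole 3 (4 * 3) 16.
Proof.
apply: (@hole_of_table 3 4 16 _ _ [::
   ([:: 17; 0; 7], [:: 9; 24; 20]); ([:: 3; 19; 6], [:: 24; 1; 27]);
   ([:: 9; 14; 2], [:: 20; 8; 15]); ([:: 9; 21; 1], [:: 24; 8; 23]);
   ([:: 0; 27; 4], [:: 12; 9; 14]); ([:: 9; 4; 5], [:: 19; 15; 21]);
   ([:: 6; 26; 1], [:: 24; 10; 16]); ([:: 9; 18; 3], [:: 15; 0; 26]);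
   ([:: 0; 25; 9], [:: 20; 4; 12]); ([:: 3; 16; 8], [:: 12; 10; 18]);
   ([:: 6; 7; 11], [:: 15; 12; 13]); ([:: 6; 5; 13], [:: 22; 17; 0]);
   ([:: 3; 22; 1], [:: 20; 10; 7]); ([:: 9; 6; 23], [:: 10; 25; 4])] [::
   ([:: 0; 1; 2], [:: 3; 4; 5])]); [by []|by []|by vm_compute].
Qed.

Lemma hole_3_12_9 : hole 3 (4 * 3) 9.
Proof.
apply: (@hole_of_table 3 4 9 _ _ [::
   ([:: 3; 1; 15], [:: 17; 10; 6]); ([:: 0; 10; 18], [:: 6; 13; 4]);
   ([:: 0; 12; 7], [:: 17; 3; 16]); ([:: 6; 10; 11], [:: 13; 15; 17]);
   ([:: 6; 20; 5], [:: 18; 9; 14]); ([:: 3; 16; 9], [:: 8; 0; 4]);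
   ([:: 6; 9; 14], [:: 8; 19; 1]); ([:: 0; 8; 19], [:: 13; 17; 5]);
   ([:: 3; 10; 2], [:: 13; 12; 20])] [::
   ([:: 0; 1; 2], [:: 3; 4; 5]); ([:: 3; 4; 5], [:: 6; 7; 8])]); [by []|by []|by vm_compute].
Qed.

Lemma hole_3_24_12 : hole 3 (4 * 3 * 2) 12.
Proof.
apply: (@hole_of_table 3 8 12 _ _ [::
   ([:: 9; 4; 0], [:: 23; 20; 35]); ([:: 28; 10; 23], [:: 3; 32; 11]);
   ([:: 0; 25; 14], [:: 12; 4; 1]); ([:: 21; 25; 6], [:: 33; 10; 20]);
   ([:: 15; 28; 14], [:: 17; 7; 16]); ([:: 12; 20; 35], [:: 27; 3; 17]);
   ([:: 6; 8; 1], [:: 13; 17; 9]); ([:: 6; 26; 18], [:: 27; 10; 28]);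
   ([:: 0; 16; 19], [:: 34; 10; 24]); ([:: 12; 7; 10], [:: 18; 13; 31]);
   ([:: 12; 31; 21], [:: 3; 8; 30]); ([:: 34; 18; 11], [:: 15; 27; 6]);
   ([:: 6; 32; 17], [:: 30; 13; 25]); ([:: 30; 4; 12], [:: 15; 26; 19]);
   ([:: 18; 3; 8], [:: 32; 29; 5]); ([:: 15; 0; 27], [:: 26; 20; 11]);
   ([:: 3; 9; 16], [:: 27; 17; 4]); ([:: 3; 4; 22], [:: 34; 31; 15]);
   ([:: 15; 1; 31], [:: 33; 30; 19]); ([:: 6; 34; 22], [:: 16; 14; 21]);
   ([:: 15; 21; 19], [:: 4; 16; 30]); ([:: 18; 19; 10], [:: 21; 25; 9]);
   ([:: 21; 24; 1], [:: 27; 10; 11]); ([:: 6; 24; 5], [:: 33; 17; 12]);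
   ([:: 12; 23; 26], [:: 24; 13; 2]); ([:: 29; 17; 19], [:: 9; 14; 33]);
   ([:: 29; 21; 2], [:: 6; 20; 28]); ([:: 6; 10; 35], [:: 23; 30; 3]);
   ([:: 21; 0; 32], [:: 35; 6; 4]); ([:: 0; 5; 33], [:: 18; 22; 11]);
   ([:: 12; 13; 9], [:: 29; 33; 5])] [::
   ([:: 0; 1; 2], [:: 3; 4; 5])]); [by []|by []|by vm_compute].
Qed.

Lemma hole_3_24_13 : hole 3 (4 * 3 * 2) 13.
Proof.
apply: (@hole_of_table 3 8 13 _ _ [::
   ([:: 3; 12; 24], [:: 25; 2; 0]); ([:: 27; 20; 15], [:: 0; 24; 25]);
   ([:: 9; 5; 34], [:: 27; 11; 1]); ([:: 26; 9; 22], [:: 3; 32; 0]);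
   ([:: 34; 21; 12], [:: 15; 32; 16]); ([:: 0; 18; 25], [:: 6; 34; 8]);
   ([:: 21; 22; 1], [:: 25; 11; 26]); ([:: 35; 1; 9], [:: 21; 5; 14]);
   ([:: 0; 8; 36], [:: 14; 35; 18]); ([:: 6; 29; 18], [:: 34; 15; 26]);
   ([:: 9; 19; 21], [:: 30; 11; 13]); ([:: 12; 27; 7], [:: 18; 5; 21]);
   ([:: 6; 21; 20], [:: 22; 4; 1]); ([:: 29; 0; 9], [:: 3; 33; 28]);
   ([:: 33; 14; 7], [:: 21; 31; 28]); ([:: 21; 14; 30], [:: 27; 29; 4]);
   ([:: 31; 23; 16], [:: 3; 29; 7]); ([:: 24; 11; 17], [:: 21; 25; 9]);
   ([:: 12; 19; 35], [:: 17; 15; 4]); ([:: 18; 33; 5], [:: 20; 10; 19]);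
   ([:: 3; 21; 28], [:: 18; 16; 13]); ([:: 15; 16; 0], [:: 36; 35; 30]);
   ([:: 15; 32; 18], [:: 33; 5; 13]); ([:: 15; 28; 1], [:: 21; 20; 31]);
   ([:: 30; 6; 19], [:: 15; 5; 22]); ([:: 32; 0; 7], [:: 12; 10; 24]);
   ([:: 0; 5; 12], [:: 20; 21; 25]); ([:: 14; 26; 8], [:: 3; 16; 10]);
   ([:: 31; 10; 6], [:: 18; 14; 9]); ([:: 3; 16; 8], [:: 36; 13; 7]);
   ([:: 9; 4; 16], [:: 18; 15; 6]); ([:: 9; 36; 12], [:: 11; 23; 13])] [::
   ([:: 0; 1; 2], [:: 3; 4; 5]); ([:: 3; 4; 5], [:: 6; 7; 8])]); [by []|by []|by vm_compute].
Qed.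

Lemma hole_3_24_16 : hole 3 (4 * 3 * 2) 16.
Proof.
apply: (@hole_of_table 3 8 16 _ _ [::
   ([:: 15; 14; 24], [:: 20; 25; 9]); ([:: 6; 19; 24], [:: 38; 35; 2]);
   ([:: 18; 23; 30], [:: 26; 39; 7]); ([:: 0; 35; 7], [:: 22; 3; 39]);
   ([:: 26; 3; 16], [:: 9; 36; 1]); ([:: 0; 31; 23], [:: 32; 7; 33]);
   ([:: 12; 13; 18], [:: 22; 35; 6]); ([:: 19; 1; 39], [:: 9; 33; 14]);
   ([:: 13; 15; 16], [:: 0; 35; 34]); ([:: 6; 10; 16], [:: 28; 17; 4]);
   ([:: 0; 30; 11], [:: 28; 16; 8]); ([:: 6; 13; 26], [:: 0; 33; 21]);
   ([:: 0; 5; 27], [:: 8; 11; 10]); ([:: 6; 37; 22], [:: 25; 20; 19]);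
   ([:: 18; 34; 2], [:: 22; 12; 13]); ([:: 3; 23; 22], [:: 34; 35; 7]);
   ([:: 3; 21; 17], [:: 12; 29; 33]); ([:: 15; 27; 21], [:: 25; 6; 7]);
   ([:: 9; 38; 13], [:: 39; 17; 30]); ([:: 37; 2; 15], [:: 3; 19; 39]);
   ([:: 9; 2; 14], [:: 35; 25; 37]); ([:: 29; 3; 11], [:: 12; 39; 2]);
   ([:: 9; 31; 12], [:: 37; 20; 6]); ([:: 12; 7; 5], [:: 19; 29; 31]);
   ([:: 4; 33; 19], [:: 0; 6; 36]); ([:: 0; 29; 17], [:: 36; 20; 18]);
   ([:: 3; 19; 20], [:: 24; 32; 17]); ([:: 9; 20; 28], [:: 18; 27; 15]);
   ([:: 38; 23; 2], [:: 18; 32; 26]); ([:: 3; 25; 10], [:: 38; 20; 32]);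
   ([:: 9; 7; 34], [:: 33; 3; 23]); ([:: 32; 3; 14], [:: 15; 30; 27]);
   ([:: 12; 21; 28], [:: 36; 24; 3]); ([:: 21; 10; 9], [:: 25; 23; 36]);
   ([:: 15; 36; 23], [:: 10; 7; 12]); ([:: 6; 17; 8], [:: 32; 31; 19])] [::
   ([:: 0; 1; 2], [:: 3; 4; 5]); ([:: 3; 4; 5], [:: 6; 7; 8])]); [by []|by []|by vm_compute].
Qed.

Lemma hole_3_24_9 : hole 3 (4 * 3 * 2) 9.
Proof.
apply: (@hole_of_table 3 8 9 _ _ [::
   ([:: 12; 20; 15], [:: 14; 22; 16]); ([:: 6; 11; 3], [:: 0; 30; 25]);
   ([:: 12; 4; 6], [:: 27; 5; 17]); ([:: 12; 21; 1], [:: 28; 13; 22]);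
   ([:: 18; 27; 3], [:: 29; 11; 16]); ([:: 6; 10; 19], [:: 28; 25; 13]);
   ([:: 25; 15; 21], [:: 12; 13; 4]); ([:: 15; 31; 2], [:: 29; 8; 18]);
   ([:: 23; 30; 5], [:: 15; 20; 21]); ([:: 21; 20; 23], [:: 29; 32; 31]);
   ([:: 15; 4; 28], [:: 27; 16; 23]); ([:: 6; 13; 29], [:: 25; 30; 5]);
   ([:: 0; 32; 7], [:: 13; 10; 6]); ([:: 15; 11; 10], [:: 32; 13; 1]);
   ([:: 24; 0; 18], [:: 6; 29; 25]); ([:: 6; 18; 20], [:: 14; 15; 0]);
   ([:: 15; 9; 22], [:: 19; 6; 12]); ([:: 22; 8; 27], [:: 6; 23; 0]);
   ([:: 0; 8; 30], [:: 25; 4; 15]); ([:: 6; 26; 15], [:: 16; 19; 14]);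
   ([:: 18; 31; 11], [:: 14; 4; 29]); ([:: 3; 13; 10], [:: 24; 31; 4]);
   ([:: 9; 24; 21], [:: 20; 16; 2]); ([:: 9; 2; 28], [:: 26; 16; 19]);
   ([:: 3; 12; 32], [:: 20; 26; 23]); ([:: 9; 13; 1], [:: 23; 24; 5]);
   ([:: 0; 5; 26], [:: 15; 18; 23])] [::
   ([:: 0; 1; 2], [:: 3; 4; 5])]); [by []|by []|by vm_compute].
Qed.

(** Here d = 4 and G = 9, beyond the bound 2d = 8. *)
Lemma hole_5_20_41 : hole 5 (4 * 5) 41.
Proof.
apply: (@hole_of_table 5 4 41 _ _ [::
   ([:: 5; 37; 16; 33; 4], [:: 36; 11; 49; 14; 55]);
   ([:: 36; 1; 44; 7; 17], [:: 10; 49; 19; 53; 18]);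
   ([:: 10; 60; 4; 29; 9], [:: 28; 8; 6; 12; 49]);
   ([:: 0; 59; 18; 41; 13], [:: 37; 7; 22; 3; 40]);
   ([:: 15; 50; 11; 56; 3], [:: 42; 5; 49; 19; 21]);
   ([:: 5; 7; 32; 17; 21], [:: 41; 56; 0; 1; 14]);
   ([:: 5; 26; 4; 20; 16], [:: 24; 11; 23; 9; 35]);
   ([:: 10; 43; 18; 9; 51], [:: 32; 3; 26; 38; 15]);
   ([:: 10; 24; 2; 22; 6], [:: 30; 16; 40; 11; 23]);
   ([:: 0; 25; 18; 38; 12], [:: 51; 10; 40; 4; 57]);
   ([:: 5; 30; 1; 48; 18], [:: 43; 16; 47; 12; 4]);
   ([:: 10; 16; 47; 8; 31], [:: 59; 18; 11; 48; 15]);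
   ([:: 15; 39; 5; 2; 45], [:: 29; 14; 33; 0; 10]);
   ([:: 5; 58; 15; 55; 13], [:: 34; 11; 60; 7; 44]);
   ([:: 10; 52; 9; 28; 4], [:: 20; 2; 45; 16; 50]);
   ([:: 0; 42; 14; 12; 35], [:: 39; 9; 13; 2; 7]);
   ([:: 0; 9; 14; 7; 27], [:: 31; 5; 23; 40; 15]);
   ([:: 15; 34; 3; 12; 54], [:: 8; 11; 58; 16; 9]);
   ([:: 5; 46; 16; 1; 57], [:: 25; 11; 14; 54; 19]);
   ([:: 15; 12; 17; 53; 2], [:: 23; 27; 52; 14; 46])] [::
   ([:: 0; 1; 2; 3; 4], [:: 5; 6; 7; 8; 9])]); [by []|by []|by vm_compute].
Qed.

(** Here d = 0 and G = 9, while the k - 1 = 4 differences serve at most 8 gadgets. *)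
Lemma hole_5_20_45 : hole 5 (4 * 5) 45.
Proof.
apply: (@hole_of_table 5 4 45 _ _ [::
   ([:: 15; 57; 5; 62; 3], [:: 25; 11; 38; 17; 61]);
   ([:: 0; 59; 5; 37; 16], [:: 42; 15; 31; 3; 54]);
   ([:: 10; 28; 4; 30; 19], [:: 54; 18; 12; 13; 44]);
   ([:: 5; 29; 2; 14; 20], [:: 43; 15; 12; 21; 1]);
   ([:: 5; 58; 14; 43; 16], [:: 28; 17; 37; 3; 47]);
   ([:: 15; 23; 5; 14; 61], [:: 64; 0; 2; 59; 7]);
   ([:: 10; 18; 31; 2; 32], [:: 47; 33; 14; 26; 8]);
   ([:: 5; 46; 13; 27; 1], [:: 11; 4; 51; 19; 36]);
   ([:: 0; 48; 12; 5; 44], [:: 47; 15; 52; 25; 13]);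
   ([:: 15; 21; 9; 53; 13], [:: 55; 3; 48; 19; 60]);
   ([:: 5; 55; 4; 40; 18], [:: 34; 12; 1; 13; 0]);
   ([:: 0; 35; 9; 19; 22], [:: 54; 14; 40; 24; 12]);
   ([:: 15; 63; 11; 13; 39], [:: 35; 0; 25; 62; 9]);
   ([:: 0; 15; 42; 6; 60], [:: 57; 20; 13; 47; 16]);
   ([:: 15; 56; 4; 13; 34], [:: 49; 8; 25; 19; 3]);
   ([:: 5; 8; 50; 0; 64], [:: 54; 30; 17; 7; 14]);
   ([:: 10; 36; 5; 33; 4], [:: 50; 17; 19; 12; 58]);
   ([:: 15; 52; 3; 51; 18], [:: 46; 5; 53; 9; 41]);
   ([:: 5; 17; 26; 12; 41], [:: 63; 32; 8; 29; 2]);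
   ([:: 5; 49; 4; 38; 13], [:: 22; 11; 45; 16; 56]);
   ([:: 24; 1; 7; 45; 13], [:: 5; 39; 27; 18; 23])] [::
   ([:: 0; 1; 2; 3; 4], [:: 5; 6; 7; 8; 9]); ([:: 5; 6; 7; 8; 9], [:: 10; 11; 12; 13; 14]);
   ([:: 10; 11; 12; 13; 14], [:: 15; 16; 17; 18; 19]);
   ([:: 15; 16; 17; 18; 19], [:: 1; 2; 3; 4; 0])]); [by []|by []|by vm_compute].
Qed.

(** * The theorem *)

Lemma mul_pred_add a r : 0 < r ->
  (a + r) * (a + r - 1) = r * (r - 1) + a * (a + r.*2 - 1).
Proof.
case: r => // r _; have -> : a + r.+1 - 1 = a + r by lia.
have -> : a + r.+1.*2 - 1 = a + r + r.+1 by lia.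
rewrite subn1 succnK; lia.
Qed.

Lemma hole_base k r : 2 < k -> odd k -> 2 * k < r < 6 * k -> 4 * k %| r * (r - 1) ->
  hole k (4 * k) r /\ hole k (4 * k * 2) r.
Proof.
move=> k_gt2 k_odd r_bounds adm; case: (leqP k 4) => k4.
  have k3 : k = 3 by lia.
  subst k.
  have : [\/ r = 9, r = 12, r = 13 | r = 16].
    suff : [|| r == 9, r == 12, r == 13 | r == 16].
      by case/or4P=> /eqP; [constructor 1|constructor 2|constructor 3|constructor 4].
    move: r_bounds adm => /andP[]; clear.
    by do 18!(case: r => [//|r]).
  case=> ->; split.
  - exact: hole_3_12_9.
  - exact: hole_3_24_9.
  - exact: hole_3_12_12.
  - exact: hole_3_24_12.
  - exact: hole_3_12_13.
  - exact: hole_3_24_13.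
  - exact: hole_3_12_16.
  - exact: hole_3_24_16.
have hole1 : hole k (4 * k) r by apply: hole_4k => //; lia.
(* The second 4k vertices are added to a remainder 4k + r < 10k, which is again admissible and for k
   = 5 may be one of the two exceptions. *)
split=> //; rewrite muln2 -addnn; apply: hole_add => //.
have [exc|not_exc] := boolP ((k == 5) && ((4 * k + r == 41) || (4 * k + r == 45))).
  have [k5 [rE|rE]] : k = 5 /\ (4 * k + r = 41 \/ 4 * k + r = 45) by lia.
    by rewrite rE k5; exact: hole_5_20_41.
  by rewrite rE k5; exact: hole_5_20_45.
apply: hole_4k => //; first lia.
rewrite mul_pred_add; last lia.
by rewrite dvdn_add // dvdn_mulr.
Qed.

Theorem theorem1p1 (k : nat) (k_ge3 : 3 <= k) (k_odd : odd k) :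
  (forall v : nat, 1 < v ->
     ((exists S, sun_system k (complete_graph v) S) <->
      (2 * k <= v /\ v * (v - 1) = 0 %[mod 4 * k])))
  <->
  (forall v : nat, 2 * k < v < 6 * k -> v * (v - 1) = 0 %[mod 4 * k] ->
     exists S, sun_system k (complete_graph v) S).
Proof.
have modE v : (v * (v - 1) = 0 %[mod 4 * k]) <-> 4 * k %| v * (v - 1).
  by rewrite mod0n; split=> [/eqP|/eqP].
split=> [all_v v v_bounds adm | small v v_gt1].
  by apply/all_v; [lia | split=> //; lia].
split=> [[S sys] | [le_v /modE adm]].
  have [le_v cardS _] := cover_of_sun_system k_ge3 v_gt1 sys.
  by split=> //; apply/modE; rewrite -cardS dvdn_mull.
(* 2k(2k - 1) is an odd multiple of 2k, so 2k is not admissible and the lower bound is strict. *)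
have adm_neq w : 4 * k %| w * (w - 1) -> w != 2 * k.
  move=> adm_w; apply/eqP => wE; have [t tE] := dvdnP adm_w; nia.
case: (ltnP v (6 * k)) => v_big.
  by apply: small; [have := adm_neq v adm; lia | apply/modE].
(* Dividing v - 2k instead of v puts r into the window from 2k to 6k. *)
pose q := (v - 2 * k) %/ (4 * k); pose r := 2 * k + (v - 2 * k) %% (4 * k).
have vE : v = 4 * k * q + r by have := divn_eq (v - 2 * k) (4 * k); rewrite /q /r; lia.
have q_gt0 : 0 < q by rewrite divn_gt0; lia.
have r_lt : r < 6 * k by have := ltn_pmod (v - 2 * k) (d := 4 * k); rewrite /r; lia.
have r_ge : 2 * k <= r by rewrite leq_addr.
move: q r vE q_gt0 r_lt r_ge => q r vE q_gt0 r_lt r_ge.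
have adm_r : 4 * k %| r * (r - 1).
  move: adm; rewrite vE mul_pred_add; last lia.
  by rewrite dvdn_addl // -mulnA dvdn_mulr.
have r_bounds : 2 * k < r < 6 * k by have := adm_neq r adm_r; lia.
have [hole1 hole2] := hole_base k_ge3 k_odd r_bounds adm_r.
have [N cov_hole NE] := hole_multiple k_ge3 k_odd q_gt0 hole1 hole2.
have [S sys] := small r r_bounds ((modE r).2 adm_r).
have r_gt1 : 1 < r by lia.
have [_ SE cov_r] := cover_of_sun_system k_ge3 r_gt1 sys.
subst v.
apply: (@sun_system_of_cover k _ k_ge3 (N + #|S|)); last first.
  by rewrite mulnDl NE SE mul_pred_add 1?addnC //; lia.
pose f2 (x : 'I_r) : 'I_(4 * k * q) + 'I_r := inr x.
have cov := sun_coverU cov_hole (sun_cover_map (E' := fun x y =>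
  exists x' y', [/\ x = f2 x', y = f2 y' & x' <> y']) (@inr_inj _ _) cov_r _).
apply: (sun_cover_map (can_inj (@unsplitK _ _)) (cov _)) => [x y [x' [y' [-> -> ne]]]|x y ne_xy].
  by exists x', y'; split=> //; left.
have ne_split : split x <> split y by move/(can_inj (@splitK _ _)).
have covered (a b : 'I_(4 * k * q) + 'I_r) : a <> b ->
    (hole_edge a b \/ exists x' y', [/\ a = f2 x', b = f2 y' & x' <> y']) \/
    (hole_edge b a \/ exists x' y', [/\ b = f2 x', a = f2 y' & x' <> y']).
  case: a b => [a|a] [b|b] ne.
  - by left; left; split=> //; exists a.
  - by left; left; split=> //; exists a.
  - by right; left; split; [move/esym | exists b].
  - by left; right; exists a, b; split=> // ab; apply: ne; rewrite ab.
by exists (split x), (split y); rewrite !splitK; split=> //; apply: covered.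
Qed.
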